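(* Let $\mathcal{G}$ be an ultragraph. If $(H,B)$ is an admissible pair in $\mathcal{G}$, then $C^*(\mathcal{G}/(H,B))\cong C^*(\mathcal{G})/I_{(H,B)}$.
   Context: An ultragraph $\mathcal{G}=(G^0,\mathcal{G}^1,r_{\mathcal{G}},s_{\mathcal{G}})$ consists of a countable vertex set $G^0$, a countable edge set $\mathcal{G}^1$, a source map $s_{\mathcal{G}}:\mathcal{G}^1\to G^0$ and a range map $r_{\mathcal{G}}:\mathcal{G}^1\to\mathcal{P}(G^0)\setminus\{\emptyset\}$. $\mathcal{G}^0$ is the smallest collection of subsets of $G^0$ containing all $\{v\}$ ($v\in G^0$) and all $r_{\mathcal{G}}(e)$ ($e\in\mathcal{G}^1$) and closed under $\cap,\cup,\setminus$. Singletons $\{v\}$ are written $v$; for a collection $H$ of sets, $v\in H$ means $\{v\}\in H$, and $G^0\setminus H$ is the set of vertices $v$ with $\{v\}\notin H$. A Cuntz-Krieger $\mathcal{G}$-family is a set of partial isometries $\{s_e:e\in\mathcal{G}^1\}$ with mutually orthogonal ranges and projections $\{p_A:A\in\mathcal{G}^0\}$ with (1) $p_\emptyset=0$, $p_Ap_B=p_{A\cap B}$, $p_{A\cup B}=p_A+p_B-p_{A\cap B}$; (2) $s_e^*s_e=p_{r_{\mathcal{G}}(e)}$; (3) $s_es_e^*\le p_{s_{\mathcal{G}}(e)}$; (4) $p_v=\sum_{s_{\mathcal{G}}(e)=v}s_es_e^*$ whenever $0<|s_{\mathcal{G}}^{-1}(v)|<\infty$. $C^*(\mathcal{G})$ is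 the $C^*$-algebra generated by a universal Cuntz-Krieger $\mathcal{G}$-family $\{s_e,p_A\}$. A (nonempty) collection $H\subseteq\mathcal{G}^0$ is hereditary if (1) $s_{\mathcal{G}}(e)\in H$ implies $r_{\mathcal{G}}(e)\in H$; (2) $A,B\in H$ implies $A\cup B\in H$; (3) $A\in H$, $B\in\mathcal{G}^0$, $B\subseteq A$ imply $B\in H$ (so $\emptyset\in H$). It is saturated if for each $v\in G^0$ with $0<|s_{\mathcal{G}}^{-1}(v)|<\infty$, $r_{\mathcal{G}}(e)\in H$ for all $e\in s_{\mathcal{G}}^{-1}(v)$ implies $v\in H$. For $H$ saturated hereditary, $B_H:=\{w\in G^0: |s_{\mathcal{G}}^{-1}(w)|=\infty,\ 0<|\{e: s_{\mathcal{G}}(e)=w,\ r_{\mathcal{G}}(e)\notin H\}|<\infty\}$. An admissible pair $(H,B)$ is a saturated hereditary $H\subseteq\mathcal{G}^0$ with a subset $B\subseteq B_H$. $I_{(H,B)}$ is the (closed two-sided) ideal of $C^*(\mathcal{G})$ generated by $\{p_A:A\in H\}\cup\{p_w^H:w\in B\}$, where $p_w^H:=p_w-\sum_{s_{\mathcal{G}}(e)=w,\ r_{\mathcal{G}}(e)\notin H}s_es_e^*$. Extended ultragraph $\overline{\mathcal{G}}=(\overline{G}^0,\overline{\mathcal{G}}^1,r',s')$ of $(H,B)$: $\overline{G}^0:=G^0\cup\{w':w\in B_H\setminus B\}$ (new vertices $w'$), $\overline{\mathcal{G}}^1:=\mathcal{G}^1$, $\overline{A}:=A\cup\{w':w\in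 A\cap(B_H\setminus B)\}$ for $A\in\mathcal{G}^0$, $r'(e):=\overline{r_{\mathcal{G}}(e)}$, and $s'(e):=(s_{\mathcal{G}}(e))'$ if $s_{\mathcal{G}}(e)\in B_H\setminus B$ and $r_{\mathcal{G}}(e)\in H$, $s'(e):=s_{\mathcal{G}}(e)$ otherwise. $\overline{\mathcal{G}}^0$ is the corresponding algebra of subsets of $\overline{G}^0$; $H\subseteq\overline{\mathcal{G}}^0$. On $\overline{\mathcal{G}}^0$ put $C\sim D$ iff $C\cup V=D\cup V$ for some $V\in H$; this is an equivalence relation, with classes $[C]$, and $\cup,\cap,\setminus$ descend to classes. $[v]$ means $[\{v\}]$. Quotient ultragraph $\mathcal{G}/(H,B)=(\Phi(G^0),\Phi(\mathcal{G}^0),\Phi(\mathcal{G}^1),r,s)$: $\Phi(G^0):=\{[v]:v\in G^0\setminus H\}\cup\{[w']:w\in B_H\setminus B\}$, $\Phi(\mathcal{G}^0):=\{[A]:A\in\overline{\mathcal{G}}^0\}$, $\Phi(\mathcal{G}^1):=\{e\in\overline{\mathcal{G}}^1:r'(e)\notin H\}$, $r(e):=[r'(e)]$, $s(e):=[s'(e)]$. A representation of $\mathcal{G}/(H,B)$ is a set of partial isometries $\{T_e:e\in\Phi(\mathcal{G}^1)\}$ and projections $\{Q_{[A]}:[A]\in\Phi(\mathcal{G}^0)\}$ in a $C^*$-algebra with (1) $Q_{[\emptyset]}=0$, $Q_{[A\cap B]}=Q_{[A]}Q_{[B]}$, $Q_{[A\cup B]}=Q_{[A]}+Q_{[B]}-Q_{[A\cap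 B]}$; (2) $T_e^*T_e=Q_{r(e)}$ and $T_e^*T_f=0$ for $e\neq f$; (3) $T_eT_e^*\leq Q_{s(e)}$; (4) $Q_{[v]}=\sum_{s(e)=[v]}T_eT_e^*$ for $[v]\in\Phi(G^0)$ with $0<|s^{-1}([v])|<\infty$. $C^*(\mathcal{G}/(H,B))$ is the universal $C^*$-algebra generated by a representation $\{t_e,q_{[A]}\}$. *)

(* Defs.v *)
From HB Require Import structures.
From mathcomp Require Import all_boot all_order all_algebra.
From mathcomp Require Import generic_quotient ring_quotient complex.
From mathcomp Require Import boolp classical_sets functions cardinality fsbigop.
From mathcomp Require Import reals topology normedtype.
From mathcomp Require Import measurable_structure.

Set Implicit Arguments.
Unset Strict Implicit.
Unset Printing Implicit Defensive.

Import Order.TTheory GRing.Theory Num.Theory.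
Import numFieldNormedType.Exports.
Local Open Scope classical_set_scope.
Local Open Scope ring_scope.
Local Open Scope quotient_scope.

(* MathComp rings are unital, hence a multiplication separate from that of
   the ring hierarchy. *)
HB.mixin Record Lmodule_isStarAlgebra (C : numClosedFieldType) A
    of GRing.Lmodule C A := {
  smul : A -> A -> A;
  star : A -> A;
  smulA : associative smul;
  smulDl : left_distributive smul +%R;
  smulDr : right_distributive smul +%R;
  smulZl : forall (c : C) x y, smul (c *: x) y = c *: smul x y;
  smulZr : forall (c : C) x y, smul x (c *: y) = c *: smul x y;
  starK : involutive star;
  starD : {morph star : x y / x + y};
  starZ : forall (c : C) x, star (c *: x) = c^* *: star x;
  starM : forall x y, star (smul x y) = smul (star y) (star x)
}.

#[short(type="starAlgType")]
HB.structure Definition StarAlgebra (C : numClosedFieldType) :=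
  {A of GRing.Lmodule C A & Lmodule_isStarAlgebra C A}.

Notation "x ** y" := (smul x y) (at level 40, left associativity) : ring_scope.

HB.mixin Record isCStarNormed (C : numClosedFieldType) A
    of CompleteNormedModule C A & Lmodule_isStarAlgebra C A := {
  smul_norm_le : forall x y : A, `|x ** y| <= `|x| * `|y|;
  cstar_norm : forall x : A, `|star x ** x| = `|x| ^+ 2
}.

#[short(type="cstarAlgType")]
HB.structure Definition CStarAlgebra (C : numClosedFieldType) :=
  {A of CompleteNormedModule C A & Lmodule_isStarAlgebra C A
      & isCStarNormed C A}.

Section StarAlgebraDefs.
Variables (C : numClosedFieldType) (A : starAlgType C).
Implicit Types x p q : A.

Definition projection p := p ** p = p /\ star p = p.

Definition partial_isometry x := x ** star x ** x = x.

(* The usual order on projections. *)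
Definition proj_le p q := q ** p = p.

End StarAlgebraDefs.

Definition star_hom (C : numClosedFieldType) (A B : starAlgType C)
    (f : A -> B) :=
  [/\ linear f, {morph f : x y / x ** y} & {morph f : x / star x}].

Section CStarDefs.
Variables (C : numClosedFieldType) (A : cstarAlgType C).

Definition cstar_subalgebra (B : set A) :=
  [/\ B 0, (forall (c : C) x y, B x -> B y -> B (c *: x + y)),
      (forall x y, B x -> B y -> B (x ** y)),
      (forall x, B x -> B (star x)) & closed B].

Definition cstar_generated (S : set A) : set A := smallest cstar_subalgebra S.

Definition closed_ideal (I : set A) :=
  [/\ I 0, (forall (c : C) x y, I x -> I y -> I (c *: x + y)),
      (forall x y, I y -> I (x ** y)), (forall x y, I x -> I (x ** y))
    & closed I].

Definition closed_ideal_generated (S : set A) : set A :=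
  smallest closed_ideal S.

End CStarDefs.

Record star_ideal (C : numClosedFieldType) (A : starAlgType C) := StarIdeal {
  ideal_set :> set A;
  ideal0 : ideal_set 0;
  idealPl : forall (c : C) x y,
    ideal_set x -> ideal_set y -> ideal_set (c *: x + y);
  idealMl : forall x y, ideal_set y -> ideal_set (x ** y);
  idealMr : forall x y, ideal_set x -> ideal_set (x ** y);
  ideal_star : forall x, ideal_set x -> ideal_set (star x)
}.

Section StarAlgebraTheory.
Variables (C : numClosedFieldType) (A : starAlgType C).
Implicit Types x y : A.

Lemma smulNl x y : (- x) ** y = - (x ** y).
Proof. by rewrite -scaleN1r smulZl scaleN1r. Qed.

Lemma smulNr x y : x ** (- y) = - (x ** y).
Proof. by rewrite -scaleN1r smulZr scaleN1r. Qed.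

Lemma smulBl x y z : (x - y) ** z = x ** z - y ** z.
Proof. by rewrite smulDl smulNl. Qed.

Lemma smulBr x y z : z ** (x - y) = z ** x - z ** y.
Proof. by rewrite smulDr smulNr. Qed.

Lemma star0 : star 0 = 0 :> A.
Proof. by rewrite -{1}(scale0r (0 : A)) starZ conjC0 scale0r. Qed.

Lemma starN x : star (- x) = - star x.
Proof. by rewrite -scaleN1r starZ conjCN1 scaleN1r. Qed.

Lemma starB x y : star (x - y) = star x - star y.
Proof. by rewrite starD starN. Qed.

End StarAlgebraTheory.

Section QuotientStarAlgebra.
Variables (C : numClosedFieldType) (A : starAlgType C) (I : star_ideal A).

Definition ideal_pred : {pred A} := fun x => x \in (I : set A).

Lemma ideal_zmod_closed : zmod_closed ideal_pred.
Proof.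
split=> [|x y]; rewrite /ideal_pred !unfold_in.
  by apply/mem_set/ideal0.
move=> /set_mem Ix /set_mem Iy; apply/mem_set.
by rewrite addrC -scaleN1r; apply: idealPl.
Qed.

HB.instance Definition _ :=
  GRing.isZmodClosed.Build A ideal_pred ideal_zmod_closed.

Definition quot_star : Type := Quotient.quot ideal_pred.

HB.instance Definition _ := EqQuotient.on quot_star.
HB.instance Definition _ := Choice.on quot_star.
HB.instance Definition _ := ZmodQuotient.on quot_star.

Definition quot_proj (x : A) : quot_star := \pi_quot_star x.

Lemma quot_projP x y : quot_proj x = quot_proj y <-> ideal_set I (x - y).
Proof.
split=> [/eqP|Ixy]; last apply/eqP.
  by rewrite -Quotient.idealrBE => /set_mem.
by rewrite -Quotient.idealrBE; apply/mem_set.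
Qed.

Lemma quot_reprK (X : quot_star) : quot_proj (repr X) = X.
Proof. exact: reprK. Qed.

Lemma quot_repr x : ideal_set I (repr (quot_proj x) - x).
Proof. by apply/quot_projP; rewrite quot_reprK. Qed.

Lemma quot_projD x y : quot_proj (x + y) = quot_proj x + quot_proj y.
Proof. exact: Quotient.pi_add. Qed.

Definition quot_scale (c : C) (X : quot_star) := quot_proj (c *: repr X).
Definition quot_mul (X Y : quot_star) := quot_proj (repr X ** repr Y).
Definition quot_adj (X : quot_star) := quot_proj (star (repr X)).

Lemma idealD x y : ideal_set I x -> ideal_set I y -> ideal_set I (x + y).
Proof. by move=> Ix Iy; rewrite -[x]scale1r; exact: idealPl. Qed.

Lemma idealZ c x : ideal_set I x -> ideal_set I (c *: x).
Proof. by move=> Ix; rewrite -[_ *: _]addr0; apply: idealPl => //; exact: ideal0. Qed.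

Lemma quot_projZ c x : quot_scale c (quot_proj x) = quot_proj (c *: x).
Proof. by apply/quot_projP; rewrite -scalerBr; apply/idealZ/quot_repr. Qed.

Lemma quot_projM x y : quot_mul (quot_proj x) (quot_proj y) = quot_proj (x ** y).
Proof.
apply/quot_projP.
rewrite -(subrK (x ** repr (quot_proj y)) (repr _ ** _)) -addrA.
rewrite -smulBl -smulBr.
by apply: idealD; [apply: idealMr|apply: idealMl]; exact: quot_repr.
Qed.

Lemma quot_proj_star x : quot_adj (quot_proj x) = quot_proj (star x).
Proof. by apply/quot_projP; rewrite -starB; apply/ideal_star/quot_repr. Qed.

Let quotE := (quot_projZ, quot_projM, quot_proj_star, =^~ quot_projD).

Lemma quot_scaleA c d X : quot_scale c (quot_scale d X) = quot_scale (c * d) X.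
Proof. by rewrite -[X]quot_reprK !quotE scalerA. Qed.

Lemma quot_scale1 : left_id 1 quot_scale.
Proof. by move=> X; rewrite -[X]quot_reprK !quotE scale1r. Qed.

Lemma quot_scaleDr : right_distributive quot_scale +%R.
Proof.
by move=> c X Y; rewrite -[X]quot_reprK -[Y]quot_reprK !quotE scalerDr.
Qed.

Lemma quot_scaleDl X : {morph quot_scale^~ X : c d / c + d}.
Proof. by move=> c d; rewrite -[X]quot_reprK !quotE scalerDl. Qed.

HB.instance Definition _ := GRing.Zmodule_isLmodule.Build C quot_star
  quot_scaleA quot_scale1 quot_scaleDr quot_scaleDl.

Lemma quot_mulA : associative quot_mul.
Proof.
move=> X Y Z; rewrite -[X]quot_reprK -[Y]quot_reprK -[Z]quot_reprK.
by rewrite !quotE smulA.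
Qed.

Lemma quot_mulDl : left_distributive quot_mul +%R.
Proof.
move=> X Y Z; rewrite -[X]quot_reprK -[Y]quot_reprK -[Z]quot_reprK.
by rewrite !quotE smulDl.
Qed.

Lemma quot_mulDr : right_distributive quot_mul +%R.
Proof.
move=> X Y Z; rewrite -[X]quot_reprK -[Y]quot_reprK -[Z]quot_reprK.
by rewrite !quotE smulDr.
Qed.

Lemma quot_mulZl (c : C) X Y : quot_mul (c *: X) Y = c *: quot_mul X Y.
Proof.
rewrite -[X]quot_reprK -[Y]quot_reprK.
by rewrite /GRing.scale/= !quotE smulZl.
Qed.

Lemma quot_mulZr (c : C) X Y : quot_mul X (c *: Y) = c *: quot_mul X Y.
Proof.
rewrite -[X]quot_reprK -[Y]quot_reprK.
by rewrite /GRing.scale/= !quotE smulZr.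
Qed.

Lemma quot_adjK : involutive quot_adj.
Proof. by move=> X; rewrite -[X]quot_reprK !quotE starK. Qed.

Lemma quot_adjD : {morph quot_adj : X Y / X + Y}.
Proof.
by move=> X Y; rewrite -[X]quot_reprK -[Y]quot_reprK !quotE starD.
Qed.

Lemma quot_adjZ (c : C) X : quot_adj (c *: X) = c^* *: quot_adj X.
Proof.
by rewrite -[X]quot_reprK /GRing.scale/= !quotE starZ.
Qed.

Lemma quot_adjM X Y : quot_adj (quot_mul X Y) = quot_mul (quot_adj Y) (quot_adj X).
Proof. by rewrite -[X]quot_reprK -[Y]quot_reprK !quotE starM. Qed.

HB.instance Definition _ := Lmodule_isStarAlgebra.Build C quot_star
  quot_mulA quot_mulDl quot_mulDr quot_mulZl quot_mulZr
  quot_adjK quot_adjD quot_adjZ quot_adjM.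

End QuotientStarAlgebra.

(* The norm of a normed module over R[i] takes values in R[i]. *)
Definition rnorm (R : realType) (A : cstarAlgType R[i]) (x : A) : R :=
  complex.Re `|x|.

Definition quotient_norm (R : realType) (A : cstarAlgType R[i])
    (I : star_ideal A) (X : quot_star I) : R :=
  inf [set rnorm a | a in [set a : A | quot_proj I a = X]].

(* Isomorphism of B with the quotient C*-algebra A/I, that is, with the
   *-algebra A/I carrying the quotient norm. *)
Definition cstar_quotient_iso (R : realType) (B A : cstarAlgType R[i])
    (I : star_ideal A) (f : B -> quot_star I) :=
  [/\ star_hom f, bijective f & forall x, quotient_norm (f x) = rnorm x].

Section SelfAdjointIdeal.
Variables (C : numClosedFieldType) (A : cstarAlgType C).

Lemma norm_star (x : A) : `|star x| = `|x|.
Proof.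
have le y : `|y| <= `|star y| :> C.
  have [->|y0] := eqVneq y 0; first by rewrite star0.
  rewrite -(@ler_pM2r _ `|y|) ?normr_gt0// -expr2 -cstar_norm.
  exact: smul_norm_le.
by apply/eqP; rewrite eq_le le -{2}[x]starK le.
Qed.

Lemma star_continuous : continuous (@star C A).
Proof.
move=> x; apply/cvgrPdist_lt => e e0.
near=> y; rewrite -starB norm_star.
by near: y; apply: cvgr_dist_lt.
Unshelve. all: by end_near. Qed.

Lemma closed_ideal_generated_closed (S : set A) :
  closed_ideal (closed_ideal_generated S).
Proof.
split.
- by move=> I [[]].
- by move=> c x y Ix Iy I II; case: (II) => -[_ + _ _ _] _; apply;
    [exact: Ix|exact: Iy].
- by move=> x y Iy I II; case: (II) => -[_ _ + _ _] _; apply; exact: Iy.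
- by move=> x y Ix I II; case: (II) => -[_ _ _ + _] _; apply; exact: Ix.
- by apply: closed_bigI => I [[]].
Qed.

Lemma closed_ideal_generated_star (S : set A) :
  (forall x, S x -> star x = x) ->
  forall x, closed_ideal_generated S x -> closed_ideal_generated S (star x).
Proof.
move=> Sadj x Ix.
have [I0 IP IMl IMr Icl] := closed_ideal_generated_closed S.
apply: (Ix (@star C A @^-1` closed_ideal_generated S)); split; last first.
  by move=> y Sy; rewrite /preimage/= (Sadj _ Sy) => I [_]; apply.
split; rewrite /preimage/=.
- by rewrite star0.
- by move=> c y z Iy Iz; rewrite starD starZ; apply: IP.
- by move=> y z Iz; rewrite starM; apply: IMr.
- by move=> y z Iy; rewrite starM; apply: IMl.
- by apply: preimage_closed Icl => y _; exact: star_continuous.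
Qed.

Section GenStarIdeal.
Variables (S : set A) (Sadj : forall x, S x -> star x = x).

Let gen := closed_ideal_generated S.

Lemma gen_ideal0 : gen 0.
Proof. by have [] := closed_ideal_generated_closed S. Qed.

Lemma gen_idealPl (c : C) x y : gen x -> gen y -> gen (c *: x + y).
Proof. by have [_ + _ _ _] := closed_ideal_generated_closed S; apply. Qed.

Lemma gen_idealMl x y : gen y -> gen (x ** y).
Proof. by have [_ _ + _ _] := closed_ideal_generated_closed S; apply. Qed.

Lemma gen_idealMr x y : gen x -> gen (x ** y).
Proof. by have [_ _ _ + _] := closed_ideal_generated_closed S; apply. Qed.

Definition gen_star_ideal : star_ideal A :=
  @StarIdeal C A (closed_ideal_generated S) gen_ideal0 gen_idealPl gen_idealMl
    gen_idealMr (closed_ideal_generated_star Sadj).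

End GenStarIdeal.

End SelfAdjointIdeal.

Record ultragraph := Ultragraph {
  vertex : countType;
  edge : countType;
  src : edge -> vertex;
  rng : edge -> set vertex;
  rng_neq0 : forall e, rng e !=set0
}.

Section UltragraphDefs.
Variable G : ultragraph.
Implicit Types (v w : vertex G) (e : edge G) (H : set (set (vertex G))).

(* The collection written G^0 with a calligraphic G. *)
Definition gsets : set (set (vertex G)) :=
  smallest [set F | [/\ setI_closed F, setU_closed F & setD_closed F]]
    (range (@set1 (vertex G)) `|` range (@rng G)).

Definition emitted v : set (edge G) := [set e | src e = v].

Definition regular v := emitted v !=set0 /\ finite_set (emitted v).

Definition hereditary H :=
  [/\ H `<=` gsets, H !=set0,
      (forall e, H [set src e] -> H (rng e)),
      (forall X Y, H X -> H Y -> H (X `|` Y)) &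
      (forall X Y, H X -> gsets Y -> Y `<=` X -> H Y)].

Definition saturated H := forall v, regular v ->
  (forall e, emitted v e -> H (rng e)) -> H [set v].

Definition edges_outside H v : set (edge G) :=
  [set e | src e = v /\ ~ H (rng e)].

Definition breaking H : set (vertex G) :=
  [set w | [/\ infinite_set (emitted w), edges_outside H w !=set0
             & finite_set (edges_outside H w)]].

Definition admissible_pair H (B : set (vertex G)) :=
  [/\ hereditary H, saturated H & B `<=` breaking H].

Lemma admissible_gsets H B : admissible_pair H B -> H `<=` gsets.
Proof. by move=> [[]]. Qed.

End UltragraphDefs.

Section CKFamily.
Variables (C : numClosedFieldType) (G : ultragraph) (A : cstarAlgType C).

(* Only the values of p on gsets G matter. *)
Record ck_family (s : edge G -> A) (p : set (vertex G) -> A) : Prop := {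
  ck_partial_isometry : forall e, partial_isometry (s e);
  ck_orthogonal : forall e f, e <> f -> star (s e) ** s f = 0;
  ck_projection : forall X, gsets X -> projection (p X);
  ck_set0 : p set0 = 0;
  ck_setI : forall X Y, gsets X -> gsets Y -> p X ** p Y = p (X `&` Y);
  ck_setU : forall X Y, gsets X -> gsets Y ->
    p (X `|` Y) = p X + p Y - p (X `&` Y);
  ck_range : forall e, star (s e) ** s e = p (rng e);
  ck_source : forall e, proj_le (s e ** star (s e)) (p [set src e]);
  ck_regular : forall v, regular v ->
    p [set v] = \sum_(e \in emitted v) (s e ** star (s e))
}.

End CKFamily.

(* C*(G): an algebra generated by a universal Cuntz-Krieger family. *)
Record ultragraph_cstar (C : numClosedFieldType) (G : ultragraph) := {
  uc_alg :> cstarAlgType C;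
  uc_s : edge G -> uc_alg;
  uc_p : set (vertex G) -> uc_alg;
  uc_family : ck_family uc_s uc_p;
  uc_generated :
    cstar_generated (range uc_s `|` [set uc_p X | X in @gsets G]) = setT;
  uc_universal : forall (D : cstarAlgType C) (S : edge G -> D)
      (P : set (vertex G) -> D), ck_family S P ->
    exists f : uc_alg -> D, [/\ star_hom f, (forall e, f (uc_s e) = S e)
      & forall X, gsets X -> f (uc_p X) = P X]
}.

Section AdmissibleIdeal.
Variables (C : numClosedFieldType) (G : ultragraph).
Variables (H : set (set (vertex G))) (B : set (vertex G)).

Section Generators.
Variables (A : cstarAlgType C) (s : edge G -> A) (p : set (vertex G) -> A).

(* The projection p_w^H. *)
Definition gap_projection (w : vertex G) : A :=
  p [set w] - \sum_(e \in edges_outside H w) (s e ** star (s e)).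

Definition ideal_generators : set A :=
  [set p X | X in H] `|` [set gap_projection w | w in B].

Lemma ideal_generators_adj : H `<=` @gsets G -> ck_family s p ->
  forall x, ideal_generators x -> star x = x.
Proof.
move=> Hg ck x [[X HX <-]|[w _ <-]].
  by have [] := ck_projection ck (Hg _ HX).
have gw : gsets [set w].
  by move=> F [_ +]; apply; left; exists w.
have [_ pw] := ck_projection ck gw.
rewrite starB pw; congr (_ - _).
rewrite (big_morph _ (@starD C A) (star0 A)); apply: eq_bigr => e _.
by rewrite starM starK.
Qed.

End Generators.

Definition admissible_ideal (adm : admissible_pair H B)
    (A : ultragraph_cstar C G) : star_ideal A :=
  gen_star_ideal
    (ideal_generators_adj (admissible_gsets adm) (uc_family A)).

End AdmissibleIdeal.

Section QuotientUltragraph.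
Variables (G : ultragraph) (H : set (set (vertex G))) (B : set (vertex G)).

Definition new_vertex := {w : vertex G | w \in breaking H `\` B}.

(* X with a new vertex added for each of its vertices in breaking H `\` B. *)
Definition xset (X : set (vertex G)) : set (vertex G + new_vertex) :=
  [set z | match z with inl v => X v | inr w => X (val w) end].

Definition xsrc (e : edge G) : vertex G + new_vertex :=
  if `[< H (rng e) >] then
    if insub (src e) is Some w then inr w else inl (src e)
  else inl (src e).

Lemma xrng_neq0 (e : edge G) : xset (rng e) !=set0.
Proof. by have [v rv] := rng_neq0 e; exists (inl v). Qed.

Definition extended : ultragraph :=
  @Ultragraph (vertex G + new_vertex)%type (edge G) xsrc (xset \o @rng G)
    xrng_neq0.

(* H seen as a collection of subsets of the extended vertex set. *)
Definition xH : set (set (vertex extended)) := [set inl @` X | X in H].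

Definition quot_equiv (X Y : set (vertex extended)) :=
  exists2 V, xH V & X `|` V = Y `|` V.

(* The class [X], as a subset of gsets extended. *)
Definition quot_class (X : set (vertex extended)) :
    set (set (vertex extended)) :=
  [set Y | gsets Y /\ quot_equiv X Y].

Definition quot_vertices : set (set (set (vertex extended))) :=
  [set quot_class [set inl v] | v in [set v | ~ H [set v]]] `|`
  [set quot_class [set inr w] | w in [set: new_vertex]].

Definition quot_sets : set (set (set (vertex extended))) :=
  [set quot_class X | X in @gsets extended].

Definition quot_edges : set (edge extended) := [set e | ~ xH (rng e)].

Definition quot_rng (e : edge extended) := quot_class (rng e).

Definition quot_src (e : edge extended) := quot_class [set src e].

Definition quot_emitted (c : set (set (vertex extended))) :
    set (edge extended) :=
  [set e | quot_edges e /\ quot_src e = c].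

End QuotientUltragraph.

Section QuotientRepresentation.
Variables (C : numClosedFieldType) (G : ultragraph).
Variables (H : set (set (vertex G))) (B : set (vertex G)).
Local Notation xG := (extended H B).
Local Notation cls := (@quot_class G H B).
Local Notation edges := (@quot_edges G H B).

(* Only the values of T on quot_edges and of Q on quot_sets matter. *)
Record quot_rep (A : cstarAlgType C) (T : edge xG -> A)
    (Q : set (set (vertex xG)) -> A) : Prop := {
  qr_partial_isometry : forall e, edges e -> partial_isometry (T e);
  qr_projection : forall c, @quot_sets G H B c -> projection (Q c);
  qr_set0 : Q (cls set0) = 0;
  qr_setI : forall X Y, gsets X -> gsets Y ->
    Q (cls (X `&` Y)) = Q (cls X) ** Q (cls Y);
  qr_setU : forall X Y, gsets X -> gsets Y ->
    Q (cls (X `|` Y)) = Q (cls X) + Q (cls Y) - Q (cls (X `&` Y));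
  qr_range : forall e, edges e -> star (T e) ** T e = Q (quot_rng e);
  qr_orthogonal : forall e f, edges e -> edges f -> e <> f ->
    star (T e) ** T f = 0;
  qr_source : forall e, edges e ->
    proj_le (T e ** star (T e)) (Q (quot_src e));
  qr_regular : forall c, @quot_vertices G H B c ->
    quot_emitted c !=set0 -> finite_set (quot_emitted c) ->
    Q c = \sum_(e \in quot_emitted c) (T e ** star (T e))
}.

(* C*(G/(H,B)): an algebra generated by a universal representation. *)
Record quotient_cstar := {
  uq_alg :> cstarAlgType C;
  uq_t : edge xG -> uq_alg;
  uq_q : set (set (vertex xG)) -> uq_alg;
  uq_rep : quot_rep uq_t uq_q;
  uq_generated :
    cstar_generated ([set uq_t e | e in edges] `|`
                     [set uq_q c | c in @quot_sets G H B]) = setT;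
  uq_universal : forall (D : cstarAlgType C) (T : edge xG -> D)
      (Q : set (set (vertex xG)) -> D), quot_rep T Q ->
    exists f : uq_alg -> D, [/\ star_hom f,
      (forall e, edges e -> f (uq_t e) = T e)
      & forall c, @quot_sets G H B c -> f (uq_q c) = Q c]
}.

End QuotientRepresentation.

(* Main.v *)
From HB Require Import structures.
Require Import Defs.
From mathcomp Require Import all_boot all_order all_algebra.
From mathcomp Require Import finmap generic_quotient complex.
From mathcomp Require Import boolp classical_sets cardinality fsbigop.
From mathcomp Require Import reals topology normedtype sequences.
From mathcomp Require Import measurable_structure ring lra.

Set Implicit Arguments.
Unset Strict Implicit.
Unset Printing Implicit Defensive.

Import Order.TTheory GRing.Theory Num.Theory.
Import numFieldNormedType.Exports.
Local Open Scope classical_set_scope.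
Local Open Scope ring_scope.
Local Open Scope complex_scope.

(** The two algebras are compared through their universal properties. In A/I the
    images of the generators s_e and of suitable projections form a
    representation of G/(H,B), which gives f : U -> A/I. In U the elements t_e,
    with 0 in place of s_e when the range of e lies in H, and the projections
    q_[xset X] form a Cuntz-Krieger G-family, which gives g : A -> U; it kills
    the generators of I, hence I. On generators f after g is the quotient map
    and the map induced by g inverts f.

    Two facts from the theory of C*-algebras carry the analysis. The first
    is that A/I with the quotient norm is a C*-algebra (qnorm_cstar,
    quot_cauchy_cvg), without which the universal property of U says nothing
    about A/I. The second is that *-homomorphisms are contractive
    (star_hom_contractive), so that a homomorphism is determined by its values
    on generators (star_hom_ext), kernels are closed, and a bijective
    homomorphism with a homomorphic inverse is isometric (inverse_pair_iso).
    Both come from fixed points. For a self-adjoint with |a| < 1 the element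
    y = 1 - sqrt (1 - a^2) is the fixed point of y |-> (a^2 + y^2) / 2, and
    a + i (1 - y) is formally unitary; this bounds the norm of a by an algebraic
    relation, which homomorphisms preserve. The C*-identity in A/I
    follows from an approximate unit u of I, the second fixed point, for which
    1 - u is contractive and i (1 - u) is small for a given i in I.

    The graph part is the construction of the projections in A/I. In A the
    projection of a vertex w of breaking H minus B plays the role of the pair
    {w, w'} of the extended ultragraph, and the gap projection of w that of w'
    alone. A set of the extended ultragraph differs from some xset X at finitely
    many new vertices, so it gets the projection p_X corrected by finitely many
    gaps (ext_proj). Since the gaps are orthogonal and p_X either absorbs or
    kills each of them, this assignment is multiplicative and additive already
    in A (ext_projI, ext_projU); modulo I it depends only on the class of the
    set. *)

(** * The norm and the contraction principle *)

Lemma subrACA (V : zmodType) (x y z t : V) : x - y - (z - t) = x - z - (y - t).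
Proof. by rewrite !opprD !opprK addrACA. Qed.

Section RealNorm.
Variables (R : realType) (A : cstarAlgType R[i]).
Implicit Types (x y a b : A) (u : nat -> A) (S : set A) (e : R).

Lemma normE x : `|x| = (rnorm x)%:C.
Proof.
by move: (normr_ge0 x); rewrite /rnorm; case: `|x| => a b;
  rewrite lecE /= => /andP[/eqP -> _].
Qed.

Lemma rnorm_ge0 x : 0 <= rnorm x.
Proof. by rewrite -lecR -normE; exact: normr_ge0. Qed.

Lemma rnorm0 : rnorm (0 : A) = 0.
Proof. by rewrite /rnorm normr0. Qed.

Lemma rnorm_eq0 x : rnorm x = 0 -> x = 0.
Proof. by move=> x0; apply/eqP; rewrite -normr_eq0 normE x0. Qed.

Lemma ler_rnormD x y : rnorm (x + y) <= rnorm x + rnorm y.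
Proof. by rewrite -lecR rmorphD /= -!normE ler_normD. Qed.

Lemma rnormN x : rnorm (- x) = rnorm x.
Proof. by rewrite /rnorm normrN. Qed.

Lemma rnorm_distC x y : rnorm (x - y) = rnorm (y - x).
Proof. by rewrite /rnorm distrC. Qed.

Lemma ler_rnormB x y : rnorm (x - y) <= rnorm x + rnorm y.
Proof. by rewrite -(rnormN y) ler_rnormD. Qed.

Lemma ler_rdistD y x z : rnorm (x - z) <= rnorm (x - y) + rnorm (y - z).
Proof. by rewrite -[x - z](subrKA y) ler_rnormD. Qed.

Lemma rnormZc (c : R[i]) x : (rnorm (c *: x))%:C = `|c| * (rnorm x)%:C.
Proof. by rewrite -!normE normrZ. Qed.

Lemma rnormZ (r : R) x : rnorm (r%:C *: x) = `|r| * rnorm x.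
Proof.
apply: complexI.
by rewrite rnormZc rmorphM /= normc_def /= expr0n addr0 sqrtr_sqr.
Qed.

Lemma rnormM x y : rnorm (x ** y) <= rnorm x * rnorm y.
Proof. by rewrite -lecR rmorphM /= -!normE smul_norm_le. Qed.

Lemma rnorm_cstar x : rnorm (star x ** x) = rnorm x ^+ 2.
Proof. by apply: complexI; rewrite -normE cstar_norm normE rmorphXn. Qed.

Lemma rnorm_star x : rnorm (star x) = rnorm x.
Proof. by rewrite /rnorm norm_star. Qed.

Lemma gt0_complexE (e : R[i]) : 0 < e -> exists2 r : R, 0 < r & e = r%:C.
Proof.
case: e => a b; rewrite ltcE /= => /andP[/eqP -> a0].
by exists a.
Qed.

Lemma closed_rnorm S :
  (forall x, (forall e, 0 < e -> exists2 y, S y & rnorm (x - y) < e) -> S x) ->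
  closed S.
Proof.
move=> h x clx; apply: h => e e0.
have [|y [Sy]] := clx (ball x e%:C); first by apply: nbhsx_ballx; rewrite ltcR.
by rewrite -ball_normE /= normE ltcR => ?; exists y.
Qed.

Lemma closed_rnormP S x : closed S ->
  (forall e, 0 < e -> exists2 y, S y & rnorm (x - y) < e) -> S x.
Proof.
move=> + h; apply => B /nbhs_ballP[_ /= /gt0_complexE[e e0 ->]].
rewrite -ball_normE => eB; have [y Sy xy] := h _ e0; exists y; split => //.
by apply: eB; rewrite /= normE ltcR.
Qed.

(** The bounds on the steps telescope, so D n bounds the distance from u n to
    every later term. *)
Lemma telescope_cvg u (D : nat -> R) : (forall n, 0 <= D n) ->
  (forall e, 0 < e -> exists n, D n < e) ->
  (forall n, rnorm (u n.+1 - u n) <= D n - D n.+1) ->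
  exists l, forall n, rnorm (l - u n) <= D n.
Proof.
move=> D0 Dlim uD.
have uDm n m : rnorm (u (n + m)%N - u n) <= D n - D (n + m)%N.
  elim: m => [|m IH]; first by rewrite addn0 !subrr rnorm0.
  have := ler_rdistD (u (n + m)%N) (u (n + m.+1)%N) (u n).
  have := uD (n + m)%N; rewrite addnS; lra.
have Ddec n m : D (n + m)%N <= D n.
  by have := uDm n m; have := rnorm_ge0 (u (n + m)%N - u n); lra.
have ucvg : cvg (u @ \oo).
  apply/cauchy_cvgP/cauchy_exP => _ /= /gt0_complexE[e e0 ->].
  have [n De] := Dlim _ e0; exists (u n), n => // m /= /subnKC <-.
  rewrite -ball_normE /= normE ltcR rnorm_distC.
  by have := uDm n (m - n)%N; have := D0 (n + (m - n))%N; lra.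
exists (lim (u @ \oo)) => n; set l := lim _.
apply/ler_addgt0Pr => e e0.
have /cvgrPdist_lt/(_ e%:C) : u @ \oo --> l by [].
rewrite ltcR => /(_ e0)[m _ /(_ (n + m)%N)] /=.
rewrite normE ltcR => /(_ (leq_addl _ _)) lu.
have := ler_rdistD (u (n + m)%N) l (u n).
by have := uDm n m; have := D0 (n + m)%N; lra.
Qed.

Lemma small_expr (K q : R) : 0 <= q < 1 ->
  forall e, 0 < e -> exists n : nat, K * q ^+ n < e.
Proof.
move=> /andP[q0 q1] e e0.
have /cvgrPdist_lt/(_ e e0)[n _ /(_ n (leqnn _))] :
    geometric K q @ \oo --> (0 : R) by apply: cvg_geometric; rewrite ger0_norm.
by rewrite /= sub0r normrN; exists n; apply: le_lt_trans (ler_norm _) _.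
Qed.

(** The iterates move by at most K q^n - K q^(n+1), where
    K = |f x0 - x0| / (1 - q). *)
Lemma contraction_fixpoint S (f : A -> A) (q : R) : 0 <= q < 1 ->
  closed S -> S !=set0 -> (forall x, S x -> S (f x)) ->
  (forall x y, S x -> S y -> rnorm (f x - f y) <= q * rnorm (x - y)) ->
  exists2 x, S x & f x = x.
Proof.
move=> /[dup] q01 /andP[q0 q1] Scl [x0 Sx0] Sf fq.
pose u n := iter n f x0.
have Su n : S (u n) by elim: n => //= n /Sf.
pose K := rnorm (f x0 - x0) / (1 - q).
have K0 : 0 <= K by rewrite divr_ge0 ?rnorm_ge0// subr_ge0 ltW.
have KE : rnorm (f x0 - x0) = K * (1 - q).
  by rewrite /K divfK// subr_eq0 gt_eqF.
have D0 n : 0 <= K * q ^+ n by rewrite mulr_ge0 ?exprn_ge0.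
have [||l lP] := @telescope_cvg u (fun n => K * q ^+ n) D0.
- exact: small_expr.
- elim=> [|n IH]; first by rewrite expr0 expr1 /= KE; lra.
  apply: le_trans (fq _ _ (Su n.+1) (Su n)) _.
  have := ler_wpM2l q0 IH.
  by rewrite (exprS q n.+1) (exprS q n); nra.
have Sl : S l.
  apply: (closed_rnormP Scl) => e /(small_expr K q01)[n ne].
  by exists (u n) => //; apply: le_lt_trans (lP n) ne.
exists l => //; apply/eqP; rewrite -subr_eq0; apply/eqP/rnorm_eq0/eqP.
rewrite eq_le rnorm_ge0 andbT; apply/ler_addgt0Pr => e e0; rewrite add0r.
have [|n ne] := small_expr (2 * K) q01 (e := e); first by [].
have := ler_rdistD (f (u n)) (f l) l; have := fq _ _ Sl (Su n).
have := lP n.+1; rewrite /= (rnorm_distC l (f _)) exprS.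
have := ler_wpM2l q0 (lP n).
have := ler_wpM2r (D0 n) (ltW q1).
by lra.
Qed.

End RealNorm.

Section ClosedSets.
Variables (R : realType) (A B : cstarAlgType R[i]).

Lemma closed_rnorm_le (r : R) : closed [set x : A | rnorm x <= r].
Proof.
apply: closed_rnorm => y yS; apply/ler_addgt0Pr => e /yS[z zr yz].
by have := ler_rdistD z y 0; rewrite !subr0; move: zr => /=; lra.
Qed.

(** Algebraic conditions such as self-adjointness or commutation with a fixed
    element define zero sets of bounded additive maps. *)
Lemma zeros_closed (g : A -> B) (M : R) :
  (forall u v, g u - g v = g (u - v)) ->
  (forall u, rnorm (g u) <= M * rnorm u) -> closed [set x | g x = 0].
Proof.
move=> gB gM; apply: closed_rnorm => y yS /=; apply: rnorm_eq0; apply/eqP.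
rewrite eq_le rnorm_ge0 andbT; apply/ler_addgt0Pr => e e0; rewrite add0r.
have M1 : 0 < `|M| + 1 by have := normr_ge0 M; lra.
have [|z Sz yz] := yS (e / (`|M| + 1)); first by rewrite divr_gt0.
move: yz; rewrite ltr_pdivlMr// => yz.
have -> : g y = g (y - z) by rewrite -gB Sz subr0.
apply: le_trans (gM _) _.
have := rnorm_ge0 (y - z); have := ler_norm M; nra.
Qed.

End ClosedSets.

Section SelfAdjointClosed.
Variables (R : realType) (A : cstarAlgType R[i]).
Implicit Types a u x : A.

Lemma selfadj_closed : closed [set x : A | star x = x].
Proof.
have -> : [set x : A | star x = x] = [set x | star x - x = 0].
  by apply/seteqP; split=> x /= /eqP h; apply/eqP; move: h; rewrite subr_eq0.
apply: (@zeros_closed _ _ _ (fun x => star x - x) 2) => [u v|u].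
  by rewrite starB subrACA.
by have := ler_rnormB (star u) u; rewrite rnorm_star; lra.
Qed.

Lemma commutant_closed a : closed [set x : A | x ** a = a ** x].
Proof.
have -> : [set x : A | x ** a = a ** x] = [set x | x ** a - a ** x = 0].
  by apply/seteqP; split=> x /= /eqP h; apply/eqP; move: h; rewrite subr_eq0.
pose g x := x ** a - a ** x.
apply: (@zeros_closed _ _ _ g (2 * rnorm a)) => [u v|u]; rewrite /g.
  by rewrite smulBl smulBr subrACA.
have := ler_rnormB (u ** a) (a ** u).
by have := rnormM u a; have := rnormM a u; nra.
Qed.

End SelfAdjointClosed.

(** * Square roots and contractivity of homomorphisms *)

Section StarAlgebraSums.
Variables (C : numClosedFieldType) (A : starAlgType C).
Implicit Types x : A.

Lemma smul0l x : 0 ** x = 0.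
Proof. by rewrite -{1}(scale0r (0 : A)) smulZl scale0r. Qed.

Lemma smul0r x : x ** 0 = 0.
Proof. by rewrite -{1}(scale0r (0 : A)) smulZr scale0r. Qed.

Lemma smul_sumr (T : Type) (r : seq T) (F : T -> A) x :
  x ** (\sum_(i <- r) F i) = \sum_(i <- r) x ** F i.
Proof. by apply: (big_morph (smul x)) => [y z|]; rewrite ?smulDr ?smul0r. Qed.

Lemma smul_suml (T : Type) (r : seq T) (F : T -> A) x :
  (\sum_(i <- r) F i) ** x = \sum_(i <- r) F i ** x.
Proof. by apply: (big_morph (smul^~ x)) => [y z|]; rewrite ?smulDl ?smul0l. Qed.

Lemma star_sum (T : Type) (r : seq T) (F : T -> A) :
  star (\sum_(i <- r) F i) = \sum_(i <- r) star (F i).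
Proof. exact: (big_morph _ (@starD C A) (star0 A)). Qed.

End StarAlgebraSums.

Section Contractions.
Variables (R : realType) (A : cstarAlgType R[i]).
Implicit Types (x y a b p s k z : A) (S : set A) (e : R).

Lemma halve_double a : (2^-1 : R)%:C *: (a + a) = a.
Proof.
rewrite scalerDr -scalerDl -rmorphD (_ : 2^-1 + 2^-1 = 1 :> R) ?scale1r//.
by field.
Qed.

Lemma conjC_real (r : R) : ((r%:C)^*)%R = r%:C :> R[i].
Proof. by apply: CrealP; rewrite complex_real. Qed.

Lemma selfadj_scale (r : R) a : star a = a -> star (r%:C *: a) = r%:C *: a.
Proof. by move=> aa; rewrite starZ aa conjC_real. Qed.

(** The elements p + i s and p - i s have the norm of b by the C*-identity, and
    p is their mean. *)
Lemma dominated_by_sum p s b :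
  star p ** p + star s ** s = star b ** b -> star p ** s = star s ** p ->
  rnorm p <= rnorm b.
Proof.
move=> psb ps.
have LE (c : R[i]) : c * (c^*)%R = 1 -> (c^*)%R = - c ->
    rnorm (p + c *: s) = rnorm b.
  move=> cc cN; apply/eqP; rewrite -(eqrXn2 (ltn0Sn 1)) ?rnorm_ge0//.
  rewrite -!rnorm_cstar starD starZ smulDl !smulDr !smulZl !smulZr ps scalerA.
  rewrite (mulrC (_^*)%R) cc scale1r cN scaleNr.
  by rewrite addrA addrK psb.
have ii : 'i * 'i^* = 1 :> R[i] by rewrite conjCi mulrN -expr2 sqrCi opprK.
have p1 := LE 'i%R ii (conjCi _).
have p2 : rnorm (p + - 'i *: s) = rnorm b.
  apply: LE; rewrite rmorphN /= conjCi ?opprK//.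
  by rewrite mulNr -expr2 sqrCi opprK.
rewrite -[p]halve_double rnormZ ger0_norm ?invr_ge0//.
have -> : p + p = (p + 'i *: s) + (p + - 'i *: s).
  by rewrite scaleNr addrACA subrr addr0.
have := ler_rnormD (p + 'i *: s) (p + - 'i *: s); rewrite p1 p2.
by move: (rnorm _) (rnorm b) => u v; lra.
Qed.

(** Formally a + i (1 - y) is unitary, since a^2 + (1 - y)^2 = 1 and the two
    terms commute, so its real and imaginary parts contract. Acting on an
    element b avoids adjoining a unit to A. *)
Lemma sqrt_contractions a y b : star a = a -> star y = y -> y ** a = a ** y ->
  y + y - y ** y = a ** a ->
  rnorm (a ** b) <= rnorm b /\ rnorm (b - y ** b) <= rnorm b.
Proof.
move=> aa yy ya yE.
have E1 : star (a ** b) ** (a ** b) + star (b - y ** b) ** (b - y ** b)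
    = star b ** b.
  rewrite starB !starM aa yy smulBl !smulBr !smulA -(smulA (star b) a a) -yE.
  rewrite smulBr smulDr smulBl smulDl !smulA.
  move: (star b ** b) (star b ** y ** b) (_ ** y ** y ** b) => u v w.
  rewrite opprB addrC addrACA.
  by rewrite [w - v - w]addrAC subrr sub0r addrA subrK addrK.
have E2 : star (a ** b) ** (b - y ** b) = star (b - y ** b) ** (a ** b).
  rewrite starB !starM aa yy smulBl !smulBr !smulA.
  by rewrite -(smulA _ a y) -ya smulA.
split; first exact: dominated_by_sum E1 E2.
by apply: (@dominated_by_sum _ (a ** b)); rewrite ?E2// addrC.
Qed.

(** Here 1 - y is the square root of 1 - a^2, and y is the fixed point of
    y |-> (a^2 + y^2) / 2, a contraction of ratio |a| on the ball of radius |a|.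
    Self-adjointness and commutation with a are closed conditions preserved by
    this map. *)
Lemma sqrt_one_minus_square a : star a = a -> rnorm a < 1 ->
  exists y, [/\ star y = y, y ** a = a ** y & y + y - y ** y = a ** a].
Proof.
move=> aa a1; pose r := rnorm a; have r0 : 0 <= r := rnorm_ge0 a.
pose S := [set y : A | [/\ star y = y, y ** a = a ** y & rnorm y <= r]].
pose f y := (2^-1 : R)%:C *: (a ** a + y ** y).
have [|||||y [yy ya _] fy] := @contraction_fixpoint R A S f r.
- by rewrite r0.
- have -> : S = [set y | star y = y] `&` [set y | y ** a = a ** y] `&`
                [set y | rnorm y <= r].
    by apply/seteqP; split=> y /= [] => [|[]].
  apply: closedI; last exact: closed_rnorm_le.
  by apply: closedI; [exact: selfadj_closed|exact: commutant_closed].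
- by exists 0; split; rewrite ?star0 ?rnorm0// smul0l smul0r.
- move=> y [yy ya yr]; rewrite /f; split.
  + by rewrite selfadj_scale// starD !starM aa yy.
  + by rewrite smulZl smulZr smulDl smulDr -!smulA ya (smulA y) ya -smulA.
  + rewrite rnormZ ger0_norm ?invr_ge0//.
    have : rnorm y * rnorm y <= r * r by apply: ler_pM => //; exact: rnorm_ge0.
    have : r * r <= r by rewrite -[leRHS]mulr1 ler_wpM2l// ltW.
    have := rnormM y y; have := rnormM a a; rewrite -/r.
    by have := ler_rnormD (a ** a) (y ** y); lra.
- move=> y z [_ _ yr] [_ _ zr]; rewrite /f.
  have -> : (2^-1)%:C *: (a ** a + y ** y) - (2^-1)%:C *: (a ** a + z ** z) =
     (2^-1 : R)%:C *: (y ** (y - z) + (y - z) ** z).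
    by rewrite -scalerBr smulBr smulBl opprD addrACA subrr add0r subrKA.
  rewrite rnormZ ger0_norm ?invr_ge0//.
  have := ler_rnormD (y ** (y - z)) ((y - z) ** z).
  have := rnormM y (y - z); have := rnormM (y - z) z.
  have := rnorm_ge0 (y - z).
  move: (rnorm (y - z)) (rnorm (y ** _)) (rnorm (_ ** z)) (rnorm (_ + _)).
  move=> d u v w d0 h1 h2 h3.
  have := ler_wpM2l d0 yr; have := ler_wpM2l d0 zr; lra.
exists y; split => //.
have : y + y = a ** a + y ** y.
  by rewrite -{1 2}fy -(halve_double (a ** a + y ** y)) scalerDr.
by move=> ->; rewrite addrK.
Qed.

(** Left multiplication by 1 - a^2 is the contraction 1 - y applied twice. *)
Lemma one_minus_square_contraction a b : star a = a -> rnorm a < 1 ->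
  rnorm (b - a ** a ** b) <= rnorm b.
Proof.
move=> aa a1; have [y [yy ya yE]] := sqrt_one_minus_square aa a1.
have -> : b - a ** a ** b = (b - y ** b) - y ** (b - y ** b).
  rewrite -yE smulBl smulDl smulBr smulA.
  by rewrite -[in LHS]addrA opprD addrA.
have [_ /le_trans] := sqrt_contractions (b - y ** b) aa yy ya yE; apply.
by have [] := sqrt_contractions b aa yy ya yE.
Qed.

End Contractions.

Section StarHomTheory.
Variables (C : numClosedFieldType) (A B D : starAlgType C) (f : A -> B).
Hypothesis fH : star_hom f.

Lemma star_homM x y : f (x ** y) = f x ** f y.
Proof. by have [_ -> _] := fH. Qed.

Lemma star_homS x : f (star x) = star (f x).
Proof. by have [_ _ ->] := fH. Qed.

Lemma star_homD x y : f (x + y) = f x + f y.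
Proof. by have [fl _ _] := fH; rewrite -[x]scale1r fl !scale1r. Qed.

Lemma star_hom0 : f 0 = 0.
Proof. by apply: (addrI (f 0)); rewrite -star_homD !addr0. Qed.

Lemma star_homZ (c : C) x : f (c *: x) = c *: f x.
Proof. by have [fl _ _] := fH; rewrite -[c *: x]addr0 fl star_hom0 addr0. Qed.

Lemma star_homN x : f (- x) = - f x.
Proof. by rewrite -scaleN1r star_homZ scaleN1r. Qed.

Lemma star_homB x y : f (x - y) = f x - f y.
Proof. by rewrite star_homD star_homN. Qed.

Lemma star_hom_comp (g : B -> D) : star_hom g -> star_hom (g \o f).
Proof.
have [fl fM fS] := fH; move=> [gl gM gS]; split.
- by move=> c x y /=; rewrite fl gl.
- by move=> x y /=; rewrite fM gM.
- by move=> x /=; rewrite fS gS.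
Qed.

End StarHomTheory.

(** The relation a^2 + (1 - y)^2 = 1 is algebraic, so f carries it to f a and
    f y, where it bounds the norm of f a by 1. *)
Lemma star_hom_contractive (R : realType) (A B : cstarAlgType R[i])
  (f : A -> B) : star_hom f -> forall x, rnorm (f x) <= rnorm x.
Proof.
move=> fH.
have f_lt1 a : star a = a -> rnorm a < 1 -> rnorm (f a) <= 1.
  move=> aa a1; have [y [yy ya yE]] := sqrt_one_minus_square aa a1.
  have fa : star (f a) = f a by rewrite -(star_homS fH) aa.
  have [||||+ _] := @sqrt_contractions _ _ (f a) (f y) (f a).
  - by [].
  - by rewrite -(star_homS fH) yy.
  - by rewrite -!(star_homM fH) ya.
  - by rewrite -!(star_homM fH) -(star_homD fH) -(star_homB fH) yE.
  rewrite -{1}fa rnorm_cstar expr2.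
  have [->|fa0] := eqVneq (rnorm (f a)) 0; first by [].
  by rewrite ger_pMr ?lt_neqAle ?rnorm_ge0 1?eq_sym ?fa0.
have f_sa a : star a = a -> rnorm (f a) <= rnorm a.
  move=> aa; apply/ler_addgt0Pr => e e0; set r := rnorm a + e.
  have r0 : 0 < r by have := rnorm_ge0 a; rewrite /r; lra.
  have := f_lt1 (r^-1%:C *: a); rewrite selfadj_scale// (star_homZ fH) !rnormZ.
  rewrite gtr0_norm ?invr_gt0// ![r^-1 * _]mulrC ltr_pdivrMr// ler_pdivrMr//.
  by rewrite !mul1r; apply; rewrite // /r ltrDl.
move=> x; rewrite -(ler_pXn2r (ltn0Sn 1)) ?nnegrE ?rnorm_ge0//.
rewrite -!rnorm_cstar -(star_homS fH) -(star_homM fH).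
by apply: f_sa; rewrite starM starK.
Qed.

(** * Quotients by closed ideals *)

Section ApproximateUnit.
Variables (R : realType) (A : cstarAlgType R[i]) (I : star_ideal A).
Hypothesis Icl : closed (I : set A).
Implicit Types (x y a b i u : A) (e : R).

Lemma idealB x y : ideal_set I x -> ideal_set I y -> ideal_set I (x - y).
Proof. by move=> Ix Iy; rewrite addrC -scaleN1r; apply: idealPl. Qed.

(** The element u = n i^2 (1 + n i^2)^-1 satisfies i^2 (1 - u) = u / n, which
    makes i (1 - u) small. With theta = n / (n + 1) it is the fixed point of
    u |-> theta (i^2 + (1 - i^2) u), a contraction because 1 - i^2 is one; this
    also exhibits 1 - u as a convex combination of 1 and (1 - i^2) (1 - u), so
    that 1 - u contracts. *)
Lemma small_ideal_unit i e : ideal_set I i -> star i = i -> rnorm i < 1 ->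
  0 < e -> exists u, [/\ ideal_set I u, star u = u,
    (forall x, rnorm (x - u ** x) <= rnorm x) & rnorm (i - i ** u) <= e].
Proof.
move=> Ii ii i1 e0; pose k := i ** i; have kk : star k = k by rewrite starM ii.
(* With this theta the bound 2 / n = 2 (1 - theta) / theta on i^2 (1 - u) is e^2. *)
pose th := 2 / (2 + e ^+ 2); have e20 : 0 < e ^+ 2 by rewrite exprn_gt0.
have den0 : 0 < 2 + e ^+ 2 by lra.
have thE : th * (2 + e ^+ 2) = 2 by rewrite divfK// gt_eqF.
have th0 : 0 < th by rewrite divr_gt0.
have th1 : th < 1 by rewrite ltr_pdivrMr// mul1r ltrDl.
pose f u := th%:C *: (k + (u - k ** u)).
pose S := [set u : A | [/\ ideal_set I u, star u = u & u ** k = k ** u]].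
have [|||||u [Iu uu uk] fu] := @contraction_fixpoint R A S f th.
- by rewrite ltW.
- have -> : S = (I : set A) `&` [set u | star u = u] `&` [set u | u ** k = k ** u].
    by apply/seteqP; split=> y /= [] => [|[]].
  apply: closedI; [apply: closedI => //; exact: selfadj_closed|].
  exact: commutant_closed.
- by exists 0; split; rewrite ?star0 ?smul0l ?smul0r//; exact: ideal0.
- move=> u [Iu uu uk]; rewrite /f; split.
  + apply: idealZ; apply: idealD; first exact: idealMl.
    by apply: idealB => //; exact: idealMl.
  + by rewrite selfadj_scale// starD kk starB starM kk uu uk.
  + by rewrite smulZl smulZr smulDl smulBl smulDr smulBr -smulA uk.
- move=> u v _ _; rewrite /f -scalerBr rnormZ gtr0_norm//.
  rewrite (ler_pM2l th0).
  rewrite opprD addrACA subrr add0r subrACA -smulBr.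
  exact: one_minus_square_contraction.
have u_contr x : rnorm (x - u ** x) <= rnorm x.
  have ux : u ** x = th%:C *: (u ** x + k ** (x - u ** x)).
    by rewrite -{1}fu smulZl smulDl smulBl smulBr smulA addrCA.
  have E : x - u ** x = (1 - th)%:C *: x +
      th%:C *: ((x - u ** x) - k ** (x - u ** x)).
    rewrite {1}ux rmorphB /= scalerBl scale1r -addrA -!scalerN -scalerDr.
    by rewrite opprD !addrA addNr add0r.
  have := ler_rnormD ((1 - th)%:C *: x) (th%:C *: ((x - u ** x) - k ** (x - u ** x))).
  rewrite -E !rnormZ (gtr0_norm th0) gtr0_norm ?subr_gt0//.
  have := one_minus_square_contraction (x - u ** x) ii i1; rewrite -/k.
  move: (rnorm (_ - k ** _)) (rnorm (x - _)) (rnorm x) => p q r pq qr.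
  have := ler_wpM2l (ltW th0) pq => h.
  by rewrite -(ler_pM2l (_ : 0 < 1 - th)) ?subr_gt0//; lra.
have u2 : rnorm u <= 2.
  have [->|/negPf u0] := eqVneq (rnorm u) 0; first by [].
  have {}u0 : 0 < rnorm u by rewrite lt_neqAle eq_sym u0 rnorm_ge0.
  rewrite -(ler_pM2l u0) -expr2 -rnorm_cstar uu.
  have := ler_rnormB u (u - u ** u); have := u_contr u.
  by rewrite opprB addrCA subrr addr0; lra.
exists u; split => //; pose z := k - k ** u.
have zE : (1 - th)%:C *: u = th%:C *: z.
  by rewrite rmorphB scalerBl scale1r -{1}fu /f -scalerBr addrCA addrAC subrr add0r.
have ze : rnorm z <= e ^+ 2.
  rewrite -(ler_pM2l th0) -{1}(gtr0_norm th0) -rnormZ -zE rnormZ.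
  by rewrite gtr0_norm ?subr_gt0//; nra.
rewrite -(ler_pXn2r (ltn0Sn 1)) ?nnegrE ?rnorm_ge0 ?(ltW e0)// -rnorm_cstar.
apply: le_trans ze; rewrite starB starM ii uu.
have -> : (i - u ** i) ** (i - i ** u) = z - u ** z.
  by rewrite smulBl !smulBr !smulA -/k.
exact: u_contr.
Qed.

Lemma ideal_unit i e : ideal_set I i -> star i = i -> 0 < e ->
  exists u, [/\ ideal_set I u, star u = u,
    (forall x, rnorm (x - u ** x) <= rnorm x) & rnorm (i - i ** u) <= e].
Proof.
move=> Ii ii e0; pose r := rnorm i + 1.
have r0 : 0 < r by rewrite ltr_wpDl ?rnorm_ge0.
have [||||u [Iu uu uc iu]] := @small_ideal_unit (r^-1%:C *: i) (r^-1 * e).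
- exact: idealZ.
- exact: selfadj_scale.
- by rewrite rnormZ gtr0_norm ?invr_gt0// mulrC ltr_pdivrMr// mul1r ltrDl.
- by rewrite mulr_gt0 ?invr_gt0.
exists u; split => //; move: iu.
by rewrite smulZl -scalerBr rnormZ gtr0_norm ?ler_pM2l ?invr_gt0.
Qed.

(** Let i be the self-adjoint part of j and u an approximate unit for i. With
    y = x u, the square of |x - y| is the norm of the compression of star x ** x
    by 1 - u; it exceeds the norm of star x ** x + i at most by that of
    i (1 - u). *)
Lemma dist_ideal_cstar x j e : ideal_set I j -> 0 < e ->
  exists2 y, ideal_set I y & rnorm (x - y) ^+ 2 <= rnorm (star x ** x + j) + e.
Proof.
move=> Ij e0; pose h a : A := (2^-1 : R)%:C *: (a + star a).
have h_sa a : star (h a) = h a.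
  by rewrite selfadj_scale// starD starK addrC.
(* Only the self-adjoint part i of j matters: h does not increase norms. *)
pose i := h j; have ii : star i = i := h_sa j.
have Ii : ideal_set I i by apply: idealZ; apply: idealD => //; exact: ideal_star.
have [u [Iu uu uc iu]] := ideal_unit Ii ii e0.
exists (x ** u); first exact: idealMl.
pose c := star x ** x + i.
have cc : star c = c by rewrite starD ii starM starK.
have cE : rnorm c <= rnorm (star x ** x + j).
  have -> : c = h (star x ** x + j).
    rewrite /h starD starM starK addrACA scalerDr -/(h j).
    by rewrite halve_double.
  rewrite rnormZ ger0_norm ?invr_ge0//.
  have := ler_rnormD (star x ** x + j) (star (star x ** x + j)).
  by rewrite rnorm_star; lra.
have cu : rnorm (c - c ** u) <= rnorm c.
  by rewrite -rnorm_star starB starM cc uu uc.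
pose w := star x ** x - star x ** x ** u.
have wE : w = (c - c ** u) - (i - i ** u).
  by rewrite subrACA -smulBl /c addrK.
have -> : rnorm (x - x ** u) ^+ 2 = rnorm (w - u ** w).
  rewrite -rnorm_cstar starB starM uu; congr rnorm.
  by rewrite smulBl !smulBr !smulA.
apply: le_trans (uc _) _; rewrite wE.
by have := ler_rnormB (c - c ** u) (i - i ** u); lra.
Qed.

End ApproximateUnit.

Section QuotientNorm.
Variables (R : realType) (A : cstarAlgType R[i]) (I : star_ideal A).
Implicit Types (a b x y : A) (X Y : quot_star I) (e : R) (c : R[i]).
Local Notation pr := (quot_proj I).
Local Notation qn := (@quotient_norm R A I).

Lemma quot_proj_star_hom : star_hom pr.
Proof.
split=> [c x y|x y|x].
- by rewrite quot_projD -(quot_projZ I).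
- by rewrite -(quot_projM I).
- by rewrite -(quot_proj_star I).
Qed.

Lemma quot_proj_eq0 x : ideal_set I x -> pr x = 0.
Proof.
move=> Ix; rewrite -(star_hom0 quot_proj_star_hom).
by apply/quot_projP; rewrite subr0.
Qed.

Lemma quot_projE X : exists x, X = pr x.
Proof. by exists (repr X); rewrite quot_reprK. Qed.

Lemma qnorm_has_inf X : has_inf [set rnorm a | a in [set a : A | pr a = X]].
Proof.
split; first by exists (rnorm (repr X)), (repr X) => //=; exact: quot_reprK.
by exists 0 => _ [a _ <-]; exact: rnorm_ge0.
Qed.

Lemma qnorm_le a : qn (pr a) <= rnorm a.
Proof. by apply: ge_inf; [exact: (qnorm_has_inf _).2|exists a]. Qed.

Lemma qnorm_lift X e : 0 < e -> exists2 a, X = pr a & rnorm a < qn X + e.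
Proof.
move=> e0; have [_ [a <- <-] ae] := inf_adherent e0 (qnorm_has_inf X).
by exists a.
Qed.

Lemma qnorm_ge0 X : 0 <= qn X.
Proof.
apply: lb_le_inf; first exact: (qnorm_has_inf X).1.
by move=> _ [a _ <-]; exact: rnorm_ge0.
Qed.

Lemma qnormD X Y : qn (X + Y) <= qn X + qn Y.
Proof.
apply/ler_addgt0Pr => e e0; have e20 : 0 < e / 2 by rewrite divr_gt0.
have [a -> ae] := qnorm_lift X e20; have [b -> be] := qnorm_lift Y e20.
rewrite -quot_projD; apply: le_trans (qnorm_le _) _.
by have := ler_rnormD a b; move: ae be; lra.
Qed.

Lemma qnormZ_le c X : ((qn (c *: X))%:C <= `|c| * (qn X)%:C)%R.
Proof.
have [s sE s0] : exists2 s : R, `|c| = s%:C & 0 <= s.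
  have := normr_ge0 c; case: `|c| => s t; rewrite lecE /= => /andP[/eqP -> s0].
  by exists s.
rewrite sE -rmorphM /= lecR; apply/ler_addgt0Pr => e e0.
have s1 : 0 < s + 1 by lra.
have [|a Xa ae] := @qnorm_lift X (e / (s + 1)); first by rewrite divr_gt0.
rewrite {1}Xa -(star_homZ quot_proj_star_hom); apply: le_trans (qnorm_le _) _.
have -> : rnorm (c *: a) = s * rnorm a.
  by apply: complexI; rewrite rnormZc sE rmorphM.
move: ae; rewrite -ltrBlDl ltr_pdivlMr// => ae.
have : (rnorm a - qn X) * s <= `|e|; last by rewrite gtr0_norm//; lra.
have [h|h] := lerP 0 (rnorm a - qn X); first by rewrite gtr0_norm//; nra.
by apply: le_trans (normr_ge0 _); nra.
Qed.

Lemma qnormZ c X : ((qn (c *: X))%:C = `|c| * (qn X)%:C)%R.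
Proof.
have [->|c0] := eqVneq c 0.
  rewrite scale0r normr0 mul0r; congr (_%:C).
  apply/eqP; rewrite eq_le qnorm_ge0 andbT -(star_hom0 quot_proj_star_hom).
  by apply: le_trans (qnorm_le _) _; rewrite rnorm0.
apply/eqP; rewrite eq_le qnormZ_le /=.
rewrite -{1}[X]scale1r -(mulVf c0) -scalerA.
by rewrite -ler_pdivlMl ?normr_gt0// -normfV qnormZ_le.
Qed.

Lemma qnorm_star X : qn (star X) = qn X.
Proof.
have le Y : qn (star Y) <= qn Y.
  apply/ler_addgt0Pr => e /(qnorm_lift Y)[a Ya ae].
  rewrite {1}Ya -(star_homS quot_proj_star_hom); apply: le_trans (qnorm_le _) _.
  by rewrite rnorm_star ltW.
by apply/eqP; rewrite eq_le le -{1}[X]starK le.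
Qed.

Lemma qnormM X Y : qn (X ** Y) <= qn X * qn Y.
Proof.
apply/ler_addgt0Pr => e e0.
(* Lifts of norm at most qn X + d and qn Y + d have a product of norm at most
   qn X * qn Y + e because d <= 1. *)
pose d := Num.min 1 (e / (qn X + qn Y + 1)).
have den : 0 < qn X + qn Y + 1 by have := qnorm_ge0 X; have := qnorm_ge0 Y; lra.
have d0 : 0 < d by rewrite lt_min ltr01 divr_gt0.
have d1 : d <= 1 by rewrite ge_min lexx.
have de : d * (qn X + qn Y + 1) <= e.
  by rewrite -ler_pdivlMr// ge_min lexx orbT.
have [a Xa ae] := qnorm_lift X d0; have [b Yb be] := qnorm_lift Y d0.
rewrite {1}Xa {1}Yb -(star_homM quot_proj_star_hom).
apply: le_trans (qnorm_le _) _; apply: le_trans (rnormM _ _) _.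
apply: le_trans (ler_pM _ _ (ltW ae) (ltW be)) _; rewrite ?rnorm_ge0//.
by nra.
Qed.

Hypothesis Icl : closed (I : set A).

Lemma qnorm_eq0 X : qn X = 0 -> X = 0.
Proof.
have [x ->] := quot_projE X => qx; apply: quot_proj_eq0.
apply: (closed_rnormP Icl) => e e0.
have [a xa] := qnorm_lift (pr x) e0; rewrite qx add0r => ae.
exists (x - a); first exact/quot_projP.
by rewrite opprB addrCA subrr addr0.
Qed.

Lemma qnorm_cstar X : qn (star X ** X) = qn X ^+ 2.
Proof.
apply/eqP; rewrite eq_le; apply/andP; split.
  by apply: le_trans (qnormM _ _) _; rewrite qnorm_star expr2.
have [x ->] := quot_projE X.
rewrite -(star_homS quot_proj_star_hom) -(star_homM quot_proj_star_hom).
apply/ler_addgt0Pr => e e0; have e20 : 0 < e / 2 by rewrite divr_gt0.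
have [c /quot_projP Ic ce] := qnorm_lift (pr (star x ** x)) e20.
have Ij : ideal_set I (c - star x ** x).
  by rewrite -opprB -scaleN1r; exact: idealZ.
have [y Iy] := dist_ideal_cstar Icl x Ij e20.
rewrite (addrC (star x ** x)) subrK => xy.
have -> : pr x = pr (x - y).
  by apply/quot_projP; rewrite opprB addrCA subrr addr0.
apply: le_trans (_ : rnorm (x - y) ^+ 2 <= _); last by lra.
by apply: lerXn2r (qnorm_le _); rewrite nnegrE ?qnorm_ge0 ?rnorm_ge0.
Qed.

End QuotientNorm.

(** The closedness of I is a parameter of the type because the norm of a coset
    separates points only for closed I. *)
Definition quot_cstar (R : realType) (A : cstarAlgType R[i]) (I : star_ideal A)
  of closed (I : set A) : Type := quot_star I.

Section QuotientCStar.
Variables (R : realType) (A : cstarAlgType R[i]) (I : star_ideal A).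
Hypothesis Icl : closed (I : set A).

HB.instance Definition _ := StarAlgebra.copy (quot_cstar Icl) (quot_star I).

Local Notation Q := (quot_cstar Icl).

Definition qnormc (X : Q) : R[i] := (@quotient_norm R A I X)%:C.

Lemma ler_qnormcD (X Y : Q) : qnormc (X + Y) <= qnormc X + qnormc Y.
Proof. by rewrite /qnormc -rmorphD /= lecR qnormD. Qed.

Lemma qnormcZ (c : R[i]) (X : Q) : qnormc (c *: X) = `|c| * qnormc X.
Proof. exact: qnormZ. Qed.

Lemma qnormc_eq0 (X : Q) : qnormc X = 0 -> X = 0.
Proof. by move=> /complexI /(qnorm_eq0 Icl). Qed.

HB.instance Definition _ :=
  Lmodule_isNormed.Build R[i] Q ler_qnormcD qnormcZ qnormc_eq0.

Lemma quot_ballE (X Y : Q) (e : R) :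
  ball X e%:C Y <-> (quotient_norm (X - Y : quot_star I) < e)%R.
Proof. by rewrite -ball_normE /ball_ /= ltcR. Qed.

(** The centres X n of balls of radius 2^-n in the filter lift to a Cauchy
    sequence of A: lift the successive differences with almost the same norm and add
    them up. *)
Lemma quot_cauchy_cvg (F : set_system Q) : ProperFilter F -> cauchy F -> cvg F.
Proof.
move=> FF /cauchyP Fc.
pose d n : R := 2^-1 ^+ n; have d0 n : 0 < d n by rewrite exprn_gt0 ?invr_gt0.
have dS n : d n.+1 = d n / 2 by rewrite /d exprSr.
have [X XF] : {X : nat -> Q & forall n, F (ball (X n) (d n)%:C)}.
  apply: (@choice _ _ (fun n (Y : Q) => F (ball Y (d n)%:C))) => n.
  by apply: Fc; rewrite ltcR.
have XX n : quotient_norm (X n.+1 - X n : quot_star I) < d n.+1 + d n.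
  have [Z [/quot_ballE ZS /ball_sym/quot_ballE Zn]] :=
    filter_ex (filterI (XF n.+1) (XF n)).
  rewrite -(subrKA (Z : quot_star I)); apply: le_lt_trans (qnormD _ _) _.
  by apply: ltrD.
have [l lP] : {l : quot_star I * nat -> A & forall Yn,
    Yn.1 = quot_proj I (l Yn) /\ rnorm (l Yn) < quotient_norm Yn.1 + d Yn.2}.
  apply: (@choice _ _ (fun (Yn : quot_star I * nat) b => Yn.1 = quot_proj I b /\
      rnorm b < quotient_norm Yn.1 + d Yn.2)) => -[Y n].
  by have [b] := qnorm_lift Y (d0 n); exists b.
pose fix a n := if n is m.+1 then a m + l (X m.+1 - X m : quot_star I, m)
                else l (X 0%N : quot_star I, 0%N).
have aX n : quot_proj I (a n) = X n.
  elim: n => [|n IH] /=; first by rewrite -(lP _).1.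
  by rewrite quot_projD IH -(lP _).1 addrC subrK.
have aa n : rnorm (a n.+1 - a n) <= 6 * d n - 6 * d n.+1.
  have -> : a n.+1 - a n = l (X n.+1 - X n : quot_star I, n).
    by rewrite /= addrAC subrr add0r.
  have /= := (lP (X n.+1 - X n : quot_star I, n)).2.
  by have := XX n; have := d0 n; rewrite dS; lra.
have [n|e e0|b bP] := telescope_cvg _ _ aa.
- by rewrite mulr_ge0// ltW.
- by apply: small_expr => //; apply/andP; split; lra.
apply/cvg_ex; exists (quot_proj I b); apply/cvg_ballP => _ /= /gt0_complexE[e e0 ->].
have [|n ne] := @small_expr R 7 2^-1 _ e e0; first by apply/andP; split; lra.
have := XF n; apply: filterS => Z /quot_ballE XZ; apply/quot_ballE.
rewrite -(subrKA (X n : quot_star I)); apply: le_lt_trans (qnormD _ _) _.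
have := qnorm_le I (b - a n); rewrite (star_homB (quot_proj_star_hom I)) aX.
by have := bP n; move: ne XZ; rewrite -/(d n); lra.
Qed.

HB.instance Definition _ := Uniform_isComplete.Build Q quot_cauchy_cvg.

Lemma qnormcM (X Y : Q) : `|X ** Y| <= `|X| * `|Y|.
Proof. by rewrite /Num.norm /= /qnormc -rmorphM /= lecR qnormM. Qed.

Lemma qnormc_cstar (X : Q) : `|star X ** X| = `|X| ^+ 2.
Proof. by rewrite /Num.norm /= /qnormc -rmorphXn /= (qnorm_cstar Icl). Qed.

HB.instance Definition _ := isCStarNormed.Build R[i] Q qnormcM qnormc_cstar.

End QuotientCStar.

Section Generated.
Variables (R : realType) (A D : cstarAlgType R[i]).
Implicit Types (f g : A -> D) (S : set A).

(** Contractivity makes the set where f and g agree closed. *)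
Lemma star_hom_ext f g S : star_hom f -> star_hom g ->
  cstar_generated S = setT -> (forall x, S x -> f x = g x) -> f =1 g.
Proof.
move=> fH gH ST fgS x.
have : cstar_generated S x by rewrite ST.
move=> /(_ [set y | f y = g y]); apply; split; last by move=> y /fgS.
split=> [|c y z /= fy fz|y z /= fy fz|y /= fy|].
- by rewrite /= (star_hom0 fH) (star_hom0 gH).
- by rewrite (star_homD fH) (star_homZ fH) fy fz -(star_homZ gH) -(star_homD gH).
- by rewrite (star_homM fH) fy fz -(star_homM gH).
- by rewrite (star_homS fH) fy -(star_homS gH).
have -> : [set y | f y = g y] = [set y | f y - g y = 0].
  by apply/seteqP; split=> y /= /eqP h; apply/eqP; move: h; rewrite subr_eq0.
apply: (@zeros_closed R A D (fun y => f y - g y) 2) => [u v|u].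
  by rewrite !(star_homB fH) !(star_homB gH) subrACA.
have := ler_rnormB (f u) (g u).
by have := star_hom_contractive fH u; have := star_hom_contractive gH u; lra.
Qed.

Lemma star_hom_kernel f : star_hom f -> closed_ideal [set x | f x = 0].
Proof.
move=> fH; split=> [|c x y /= fx fy|x y /= fy|x y /= fx|].
- by rewrite /= (star_hom0 fH).
- by rewrite (star_homD fH) (star_homZ fH) fx fy scaler0 addr0.
- by rewrite (star_homM fH) fy smul0r.
- by rewrite (star_homM fH) fx smul0l.
apply: (@zeros_closed R A D f 1) => [u v|u]; first by rewrite (star_homB fH).
by rewrite mul1r star_hom_contractive.
Qed.

End Generated.

Lemma star_hom_fsum (C : numClosedFieldType) (A D : starAlgType C) (f : A -> D)
    (T : choiceType) (E : set T) (F : T -> A) : star_hom f -> finite_set E ->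
  f (\sum_(e \in E) F e) = \sum_(e \in E) f (F e).
Proof.
move=> fH Efin; rewrite !fsbig_finite//.
exact: (big_morph f (star_homD fH) (star_hom0 fH)).
Qed.

(** * Vertex sets of the extended and of the quotient ultragraph *)

Section GSets.
Variable G : ultragraph.
Implicit Types (v : vertex G) (e : edge G) (X Y : set (vertex G)).

Lemma gsets_closed : [/\ setI_closed (@gsets G), setU_closed (@gsets G)
  & setD_closed (@gsets G)].
Proof.
split=> X Y gX gY F FH; have [[FI FU FD] _] := FH.
- by apply: FI; [exact: gX|exact: gY].
- by apply: FU; [exact: gX|exact: gY].
- by apply: FD; [exact: gX|exact: gY].
Qed.

Lemma gsetsI X Y : gsets X -> gsets Y -> gsets (X `&` Y).
Proof. by have [h _ _] := gsets_closed; exact: h. Qed.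

Lemma gsetsU X Y : gsets X -> gsets Y -> gsets (X `|` Y).
Proof. by have [_ h _] := gsets_closed; exact: h. Qed.

Lemma gsetsD X Y : gsets X -> gsets Y -> gsets (X `\` Y).
Proof. by have [_ _ h] := gsets_closed; exact: h. Qed.

Lemma gsets1 v : gsets [set v].
Proof. by move=> F [_ +]; apply; left; exists v. Qed.

Lemma gsets_rng e : gsets (rng e).
Proof. by move=> F [_ +]; apply; right; exists e. Qed.

Lemma gsets_ind (K : set (set (vertex G))) :
  (forall v, K [set v]) -> (forall e, K (rng e)) ->
  (forall X Y, gsets X -> gsets Y -> K X -> K Y -> K (X `&` Y)) ->
  (forall X Y, gsets X -> gsets Y -> K X -> K Y -> K (X `|` Y)) ->
  (forall X Y, gsets X -> gsets Y -> K X -> K Y -> K (X `\` Y)) ->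
  forall X, gsets X -> K X.
Proof.
move=> K1 Kr KI KU KD X gX.
suff [] : (@gsets G `&` K) X by [].
apply: gX; split; last first.
  move=> Y [[v _ <-]|[e _ <-]]; split => //; [exact: gsets1|exact: gsets_rng].
split=> Y Z [gY KY] [gZ KZ]; split.
- exact: gsetsI.
- exact: KI.
- exact: gsetsU.
- exact: KU.
- exact: gsetsD.
- exact: KD.
Qed.

End GSets.

Section QuotientSets.
Variables (G : ultragraph) (H : set (set (vertex G))) (B : set (vertex G)).
Hypothesis adm : admissible_pair H B.
Local Notation xG := (extended H B).
Local Notation cls := (@quot_class G H B).
Local Notation xs := (@xset G H B).
Implicit Types (v w : vertex G) (e : edge G) (X Y : set (vertex G)).
Implicit Types (C D : set (vertex xG)).

Let her : hereditary H. Proof. by have [] := adm. Qed.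

Lemma hereditary0 : H set0.
Proof.
have [Hg [X HX] _ _ Hsub] := her; apply: (Hsub X set0) => //.
by rewrite -(setDv X); apply: gsetsD; exact: Hg.
Qed.

Lemma hereditary1 X v : H X -> X v -> H [set v].
Proof.
by have [_ _ _ _ Hs] := her => HX Xv; apply: (Hs X) => //;
  [exact: gsets1|move=> _ ->].
Qed.

Lemma emitted_hereditary e : H [set src e] -> H (rng e).
Proof. by have [_ _ h _ _] := her; exact: h. Qed.

(** A breaking vertex emits an edge whose range is not in H, so no new vertex
    comes from a member of H. *)
Lemma breaking_notin_hereditary X v : H X -> X v -> ~ breaking H v.
Proof.
move=> HX Xv [_ [e [ev +]] _]; apply.
by apply: emitted_hereditary; rewrite ev; exact: hereditary1 Xv.
Qed.

Lemma xsetI X Y : xs (X `&` Y) = xs X `&` xs Y.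
Proof. by apply/seteqP; split=> -[]. Qed.

Lemma xsetU X Y : xs (X `|` Y) = xs X `|` xs Y.
Proof. by apply/seteqP; split=> -[]. Qed.

Lemma xsetD X Y : xs (X `\` Y) = xs X `\` xs Y.
Proof. by apply/seteqP; split=> -[]. Qed.

Lemma xset_new (w : new_vertex H B) :
  xs [set val w] = [set inl (val w)] `|` [set inr w].
Proof.
apply/seteqP; split=> -[v|w'] /=.
- by move=> ->; left.
- by move=> /val_inj ->; right.
- by case=> // -[->].
- by case=> // -[->].
Qed.

Lemma xset_old v : ~ (breaking H `\` B) v -> xs [set v] = [set inl v].
Proof.
move=> vN; apply/seteqP; split=> -[u|w] /=.
- by move=> ->.
- by move=> wv; case: vN; rewrite -wv; exact/set_mem/(valP w).
- by case=> ->.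
- by [].
Qed.

Lemma new_vertexP v : (breaking H `\` B) v -> exists w : new_vertex H B, val w = v.
Proof. by move=> vN; exists (exist _ v (mem_set vN)). Qed.

Lemma gsets_inl v : gsets ([set inl v] : set (vertex xG)).
Proof. exact: gsets1. Qed.

Lemma gsets_inr (w : new_vertex H B) : gsets ([set inr w] : set (vertex xG)).
Proof. exact: gsets1. Qed.

Lemma gsets_xset X : gsets X -> gsets (xs X : set (vertex xG)).
Proof.
move: X; apply: gsets_ind => [v|e|X Y _ _|X Y _ _|X Y _ _].
- have [/new_vertexP[w <-]|/xset_old ->] := pselect ((breaking H `\` B) v).
    by rewrite xset_new; apply: gsetsU; [exact: gsets_inl|exact: gsets_inr].
  exact: gsets_inl.
- exact: (@gsets_rng xG e).
- by rewrite xsetI; exact: gsetsI.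
- by rewrite xsetU; exact: gsetsU.
- by rewrite xsetD; exact: gsetsD.
Qed.

Lemma xset_hereditary X : H X -> xs X = inl @` X.
Proof.
move=> HX; apply/seteqP; split=> -[v|w] /=.
- by move=> Xv; exists v.
- move=> /(breaking_notin_hereditary HX); case.
  by have /set_mem[] := valP w.
- by case=> u Xu [<-].
- by case.
Qed.

Lemma quot_equiv_refl C : quot_equiv C C.
Proof. by exists (inl @` set0) => //; exists set0 => //; exact: hereditary0. Qed.

Lemma quot_equiv_sym C D : quot_equiv C D -> quot_equiv D C.
Proof. by case=> V HV CD; exists V. Qed.

Lemma quot_equiv_trans C D E :
  quot_equiv C D -> quot_equiv D E -> quot_equiv C E.
Proof.
have [_ _ _ HU _] := her.
move=> [_ [X HX <-] CD] [_ [Y HY <-] DE]; exists (inl @` (X `|` Y)).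
  by exists (X `|` Y) => //; exact: HU.
by rewrite image_setU setUA CD setUAC DE -setUA (setUC (_ @` Y)).
Qed.

Lemma quot_class_eq C D : quot_equiv C D -> cls C = cls D.
Proof.
move=> CD; apply/seteqP; split=> E [gE h]; split => //.
  exact: quot_equiv_trans (quot_equiv_sym CD) h.
exact: quot_equiv_trans CD h.
Qed.

Lemma quot_class_inv C D : gsets C -> cls C = cls D -> quot_equiv C D.
Proof.
move=> gC CD; have [_ h] : cls D C by rewrite -CD; split => //; exact: quot_equiv_refl.
exact: quot_equiv_sym.
Qed.

Lemma quot_class_hereditary X : H X -> cls (xs X) = cls set0.
Proof.
move=> HX; apply: quot_class_eq; exists (xs X); last by rewrite setUid set0U.
by exists X => //; rewrite xset_hereditary.
Qed.

Lemma quot_edgesE e : @quot_edges G H B e <-> ~ H (rng e).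
Proof.
split=> + He; apply; first by exists (rng e) => //; rewrite -xset_hereditary.
case: He => X HX /seteqP[XE EX].
suff -> : rng e = X by [].
apply/seteqP; split=> v.
  by move=> ev; have [|u Xu [<-]//] := EX (inl v).
by move=> Xv; apply: (XE (inl v)); exists v.
Qed.

Lemma xsrcE e : ~ H (rng e) -> xsrc H B e = inl (src e).
Proof. by move=> He; rewrite /xsrc; case: asboolP. Qed.

(** Identifying inl u with inl v for u <> v takes a member of H that contains v. *)
Lemma quot_emitted_inl v : ~ H [set v] ->
  quot_emitted (cls [set inl v]) = edges_outside H v.
Proof.
move=> Hv; apply/seteqP; split=> e.
  move=> [/quot_edgesE He]; rewrite /quot_src /= xsrcE// => ev; split => //.
  have [_ [X HX <-] /seteqP[_ vE]] := quot_class_inv (gsets_inl _) ev.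
  have [|[->//]|[u Xu [uv]]] := vE (inl v); first by left.
  by case: Hv; apply: hereditary1 HX _; rewrite -uv.
move=> [ev He]; split; first exact/quot_edgesE.
by rewrite /quot_src /= xsrcE// ev.
Qed.

(** The edges moved to a new vertex are those with range in H. *)
Lemma quot_emitted_inr (w : new_vertex H B) :
  quot_emitted (cls [set inr w]) = set0.
Proof.
apply/seteqP; split=> e // [/quot_edgesE He]; rewrite /quot_src /= xsrcE// => ew.
have [_ [X HX <-] /seteqP[_ wE]] := quot_class_inv (gsets_inl _) ew.
by have [|//|[u Xu]] := wE (inr w); first by left.
Qed.

End QuotientSets.

(** * Projections for the extended ultragraph *)

Section ExtendedFamily.
Variables (K : numClosedFieldType) (G : ultragraph).
Variables (H : set (set (vertex G))) (B : set (vertex G)).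
Hypothesis adm : admissible_pair H B.
Variables (A : cstarAlgType K) (s : edge G -> A) (p : set (vertex G) -> A).
Hypothesis ck : ck_family s p.
Local Notation xG := (extended H B).
Local Notation xs := (@xset G H B).
Local Notation gap := (gap_projection H s p).
Implicit Types (v : vertex G) (e f : edge G) (X Y : set (vertex G)).
Implicit Types (C D : set (vertex xG)) (w : new_vertex H B).

Local Notation rp e := (s e ** star (s e)).

Lemma range_projM e f : rp e ** rp f = if e == f then rp e else 0.
Proof.
case: eqVneq => [<-|/eqP ef]; first by rewrite smulA (ck_partial_isometry ck).
by rewrite -smulA (smulA _ (s f)) (ck_orthogonal ck) // smul0l smul0r.
Qed.

Lemma range_projS e : star (rp e) = rp e.
Proof. by rewrite starM starK. Qed.

Lemma ck_rangeM X e : gsets X ->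
  p X ** rp e = if `[< X (src e) >] then rp e else 0.
Proof.
move=> gX; rewrite -{1}(ck_source ck) smulA (ck_setI ck)//; last exact: gsets1.
case: asboolP => Xe.
  rewrite (_ : X `&` _ = [set src e]) ?(ck_source ck)//.
  by apply/seteqP; split=> [u []|_ ->].
rewrite (_ : X `&` _ = set0) ?(ck_set0 ck) ?smul0l//.
by apply/seteqP; split=> [u [Xu uE]|//]; apply: Xe; rewrite -uE.
Qed.

(** The part of p [set v] complementary to the gap: the range projection of the
    edges out of v that survive in the quotient. *)
Definition core v : A := \sum_(e \in edges_outside H v) rp e.

Lemma gapE v : gap v = p [set v] - core v. Proof. by []. Qed.

Section Core.
Variables (v : vertex G) (vfin : finite_set (edges_outside H v)).

Let coreE : core v = \sum_(e <- fset_set (edges_outside H v)) rp e.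
Proof. exact: fsbig_finite. Qed.

Lemma core_rangeM e : edges_outside H v e -> core v ** rp e = rp e.
Proof.
move=> ve; rewrite coreE smul_suml (big_rem e) /=; last first.
  by rewrite in_fset_set//; exact: mem_set.
rewrite range_projM eqxx big_seq big1 ?addr0// => f.
by rewrite (mem_rem_uniq _ (fset_uniq _)) inE => /andP[/negPf fe _]; rewrite range_projM fe.
Qed.

Lemma core_star : star (core v) = core v.
Proof. by rewrite coreE star_sum; apply: eq_bigr => e _; exact: range_projS. Qed.

Lemma core_idem : core v ** core v = core v.
Proof.
rewrite {2}coreE smul_sumr [RHS]coreE !big_seq; apply: eq_bigr => e.
by rewrite in_fset_set// inE => /core_rangeM.
Qed.

Lemma ck_coreM X : gsets X -> p X ** core v = if `[< X v >] then core v else 0.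
Proof.
move=> gX; rewrite coreE smul_sumr big_seq.
under eq_bigr => e.
  rewrite in_fset_set// inE => -[ev _]; rewrite ck_rangeM// ev; over.
by case: ifP => _; rewrite -big_seq// big1.
Qed.

Lemma gap_star : star (gap v) = gap v.
Proof.
rewrite gapE starB core_star; congr (_ - _).
by have [] := ck_projection ck (gsets1 v).
Qed.

Lemma ck_gapM X : gsets X -> p X ** gap v = if `[< X v >] then gap v else 0.
Proof.
move=> gX; rewrite gapE smulBr ck_coreM// (ck_setI ck)//; last exact: gsets1.
case: asboolP => Xv.
  rewrite (_ : X `&` _ = [set v])//.
  by apply/seteqP; split=> [u []|_ ->].
rewrite (_ : X `&` _ = set0) ?(ck_set0 ck) ?subr0//.
by apply/seteqP; split=> [u [Xu uE]|//]; apply: Xv; rewrite -uE.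
Qed.

Lemma gap_ckM X : gsets X -> gap v ** p X = if `[< X v >] then gap v else 0.
Proof.
move=> gX; have [_ pX] := ck_projection ck gX.
rewrite -[LHS]starK starM pX gap_star ck_gapM//.
by case: ifP => _; rewrite ?gap_star ?star0.
Qed.

Lemma gap_idem : gap v ** gap v = gap v.
Proof.
have pv : p [set v] ** core v = core v by rewrite ck_coreM; [rewrite asboolT|exact: gsets1].
have gc : core v ** gap v = 0.
  rewrite gapE smulBr core_idem.
  have -> : core v ** p [set v] = core v.
    have [_ ps] := ck_projection ck (gsets1 v).
    by rewrite -[LHS]starK starM ps core_star pv core_star.
  by rewrite subrr.
rewrite {1}gapE smulBl gc subr0 ck_gapM; last exact: gsets1.
by rewrite asboolT.
Qed.

End Core.

Lemma gapM v u : finite_set (edges_outside H v) -> finite_set (edges_outside H u) ->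
  gap v ** gap u = if v == u then gap v else 0.
Proof.
move=> vfin ufin; case: eqVneq => [<-|/eqP vu]; first exact: gap_idem.
have -> : gap v = gap v ** p [set v].
  by rewrite gap_ckM ?asboolT//; exact: gsets1.
rewrite -smulA ck_gapM//; last exact: gsets1.
by rewrite asboolF ?smul0r// => uv; apply: vu.
Qed.

Definition new_coef C w : K :=
  `[< C (inr w) >]%:R - `[< C (inl (val w)) >]%:R.

(** In a G-family the vertex w stands for w and w' together and its gap is the
    share of w', so the gap is added when C contains only w' and removed when it
    contains only w. *)
Definition ext_proj C : A :=
  p (inl @^-1` C) + \sum_(w \in [set: new_vertex H B]) new_coef C w *: gap (val w).

(** The finiteness condition holds on gsets (gsets_almost_xset) and makes the sum
    in ext_proj a finite one. *)
Definition almost_xset C :=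
  gsets (inl @^-1` C : set (vertex G)) /\ finite_set [set w | new_coef C w != 0].

Lemma new_edges_finite w : finite_set (edges_outside H (val w)).
Proof. by have /set_mem[[]] := valP w. Qed.

Lemma new_coef_inr w w' : new_coef [set inr w] w' = (w' == w)%:R.
Proof.
rewrite /new_coef [X in _ - X](_ : _ = 0) ?subr0; last by rewrite asboolF.
by case: eqVneq => [->|/eqP w'w]; [rewrite asboolT|rewrite asboolF// => -[]].
Qed.

Lemma new_coef_inl v w : new_coef [set inl v] w = - (val w == v)%:R.
Proof.
rewrite /new_coef [X in X - _](_ : _ = 0) ?sub0r; last by rewrite asboolF.
by case: eqVneq => [->|/eqP wv]; [rewrite asboolT|rewrite asboolF// => -[]].
Qed.

Lemma new_coef_xset X w : new_coef (xs X) w = 0.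
Proof. by rewrite /new_coef subrr. Qed.

Lemma new_coefI C D w : new_coef (C `&` D) w =
  `[< C (inr w) >]%:R * `[< D (inr w) >]%:R
  - `[< C (inl (val w)) >]%:R * `[< D (inl (val w)) >]%:R.
Proof. by rewrite /new_coef !asbool_and -!natrM !mulnb. Qed.

Lemma new_coefU C D w :
  new_coef (C `|` D) w = new_coef C w + new_coef D w - new_coef (C `&` D) w.
Proof.
rewrite new_coefI /new_coef !asbool_or.
by do 4 case: asboolP => _ /=; ring.
Qed.

Lemma new_coefD C D w : new_coef (C `\` D) w = new_coef C w - new_coef (C `&` D) w.
Proof.
rewrite new_coefI /new_coef !asbool_and !asbool_neg.
by do 4 case: asboolP => _ /=; ring.
Qed.

Lemma almost_xset_support C D : almost_xset C -> almost_xset D ->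
  exists2 r : seq (new_vertex H B), uniq r & forall w, w \notin r ->
    [/\ new_coef C w = 0, new_coef D w = 0 & new_coef (C `&` D) w = 0].
Proof.
move=> [_ Cfin] [_ Dfin].
have Efin : finite_set ([set w | new_coef C w != 0] `|` [set w | new_coef D w != 0]).
  by rewrite finite_setU.
exists (fset_set ([set w | new_coef C w != 0] `|` [set w | new_coef D w != 0])).
  exact: fset_uniq.
move=> w; rewrite in_fset_set// => /negP wE.
have [C0 D0] : new_coef C w = 0 /\ new_coef D w = 0.
  by split; apply: contrapT => /eqP h; apply: wE; apply/mem_set; [left|right].
split=> //; move: C0 D0; rewrite new_coefI /new_coef => /subr0_eq -> /subr0_eq ->.
by rewrite subrr.
Qed.

Lemma ext_projE C (r : seq (new_vertex H B)) : uniq r ->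
  (forall w, w \notin r -> new_coef C w = 0) ->
  ext_proj C = p (inl @^-1` C) + \sum_(w <- r) new_coef C w *: gap (val w).
Proof.
move=> ru rC; congr (_ + _); rewrite (fsbig_seq _ _ ru).
apply/esym/fsbig_widen => // w [_ /=] /negP wr.
by rewrite rC ?scale0r.
Qed.

Lemma almost_xsetI C D : almost_xset C -> almost_xset D -> almost_xset (C `&` D).
Proof.
move=> aC aD; have [r _ rP] := almost_xset_support aC aD; split.
  by case: aC aD => gC _ [gD _]; exact: gsetsI.
apply: (@sub_finite_set _ _ [set` r]) => // w /= w0.
by apply: contraNT w0 => /rP[_ _ ->].
Qed.

Lemma almost_xsetU C D : almost_xset C -> almost_xset D -> almost_xset (C `|` D).
Proof.
move=> aC aD; have [r _ rP] := almost_xset_support aC aD; split.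
  by case: aC aD => gC _ [gD _]; exact: gsetsU.
apply: (@sub_finite_set _ _ [set` r]) => // w /= w0.
by apply: contraNT w0 => /rP[C0 D0 CD0]; rewrite new_coefU C0 D0 CD0 addr0 subr0.
Qed.

Lemma almost_xsetD C D : almost_xset C -> almost_xset D -> almost_xset (C `\` D).
Proof.
move=> aC aD; have [r _ rP] := almost_xset_support aC aD; split.
  by case: aC aD => gC _ [gD _]; exact: gsetsD.
apply: (@sub_finite_set _ _ [set` r]) => // w /= w0.
by apply: contraNT w0 => /rP[C0 _ CD0]; rewrite new_coefD C0 CD0 subr0.
Qed.

Lemma gsets_almost_xset C : gsets C -> almost_xset C.
Proof.
move: C; apply: gsets_ind => [[v|w]|e|C D _ _|C D _ _|C D _ _].
- split.
    rewrite (_ : _ @^-1` _ = [set v]); first exact: gsets1.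
    by apply/seteqP; split=> [u [->]|u ->].
  apply: (@sub_finite_set _ _ (val @^-1` [set v])) => [w /=|].
    by rewrite new_coef_inl oppr_eq0 pnatr_eq0 eqb0 negbK => /eqP.
  apply: finite_preimage => //; exact: in2W val_inj.
- split.
    rewrite (_ : _ @^-1` _ = set0); last by apply/seteqP; split.
    exact: (admissible_gsets adm) (hereditary0 adm).
  apply: (@sub_finite_set _ _ [set w]) => [w' /=|//].
  by rewrite new_coef_inr pnatr_eq0 eqb0 negbK => /eqP.
- split; first exact: gsets_rng.
  apply: (@sub_finite_set _ _ set0) => // w /=.
  by rewrite new_coef_xset eqxx.
- exact: almost_xsetI.
- exact: almost_xsetU.
- exact: almost_xsetD.
Qed.

Lemma ext_proj_xset X : ext_proj (xs X) = p X.
Proof.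
rewrite (@ext_projE _ [::])// ?big_nil ?addr0// => w _.
exact: new_coef_xset.
Qed.

Lemma ext_proj_inr w : ext_proj [set inr w] = gap (val w).
Proof.
rewrite (@ext_projE _ [:: w])//; last first.
  by move=> w'; rewrite inE new_coef_inr => /negPf ->.
rewrite big_seq1 new_coef_inr eqxx scale1r (_ : _ @^-1` _ = set0).
  by rewrite (ck_set0 ck) add0r.
by apply/seteqP; split.
Qed.

Lemma ext_proj_new w : ext_proj [set inl (val w)] = core (val w).
Proof.
rewrite (@ext_projE _ [:: w])//; last first.
  by move=> w'; rewrite inE new_coef_inl (inj_eq val_inj) => /negPf ->; rewrite oppr0.
rewrite big_seq1 new_coef_inl eqxx scaleN1r (_ : _ @^-1` _ = [set val w]).
  by rewrite gapE opprB addrCA subrr addr0.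
by apply/seteqP; split=> [u [->]|u ->].
Qed.

Lemma ext_projU C D : gsets C -> gsets D ->
  ext_proj (C `|` D) = ext_proj C + ext_proj D - ext_proj (C `&` D).
Proof.
move=> /gsets_almost_xset aC /gsets_almost_xset aD.
have [r ru rP] := almost_xset_support aC aD.
rewrite !(@ext_projE _ r)//; try by move=> w /rP[C0 D0 CD0];
  rewrite ?new_coefU ?C0 ?D0 ?CD0 ?addr0 ?subr0.
rewrite preimage_setU preimage_setI (ck_setU ck aC.1 aD.1).
rewrite addrACA opprD [RHS]addrACA; congr (_ + _).
rewrite -big_split -sumrB; apply: eq_bigr => w _ /=.
by rewrite new_coefU scalerBl scalerDl.
Qed.

(** The projection p X absorbs the gap of w if w is in X and kills it otherwise,
    and distinct gaps are orthogonal, so the claim is an identity between the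
    coefficients of each gap. *)
Lemma ext_projI C D : gsets C -> gsets D ->
  ext_proj (C `&` D) = ext_proj C ** ext_proj D.
Proof.
move=> /gsets_almost_xset aC /gsets_almost_xset aD.
have [r ru rP] := almost_xset_support aC aD.
rewrite !(@ext_projE _ r)//; try by move=> w /rP[].
rewrite smulDl !smulDr (ck_setI ck aC.1 aD.1) preimage_setI -addrA.
congr (_ + _); rewrite !smul_sumr !smul_suml.
rewrite -!big_split !big_seq; apply: eq_bigr => w wr /=.
rewrite smulZr smulZl (ck_gapM (new_edges_finite w) aC.1).
rewrite (gap_ckM (new_edges_finite w) aD.1) -big_seq smul_suml (bigD1_seq w)//= big1 ?addr0.
  rewrite smulZl smulZr gapM ?eqxx; [|exact: new_edges_finite..].
  rewrite scalerA new_coefI /new_coef /preimage /mkset /=.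
  case: (asboolP (C (inl (val w)))) => _; case: (asboolP (D (inl (val w)))) => _;
    rewrite ?scaler0 ?addr0 ?add0r -?scalerDl; congr (_ *: _) => /=; ring.
move=> w' /eqP w'w; rewrite smulZl smulZr gapM; [|exact: new_edges_finite..].
by rewrite (inj_eq val_inj); case: eqVneq => [/w'w//|_]; rewrite !scaler0.
Qed.

Lemma ext_proj_star C : gsets C -> star (ext_proj C) = ext_proj C.
Proof.
move=> /gsets_almost_xset aC.
have [r ru rP] := almost_xset_support aC aC.
rewrite (@ext_projE _ r)//; last by move=> w /rP[].
have [_ pC] := ck_projection ck aC.1.
rewrite starD pC star_sum; congr (_ + _); apply: eq_bigr => w _.
rewrite starZ gap_star; last exact: new_edges_finite.
by rewrite /new_coef rmorphB !rmorph_nat.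
Qed.

End ExtendedFamily.

(** * Representations of the quotient and Cuntz-Krieger families *)

Section PushedRepresentation.
Variables (K : numClosedFieldType) (G : ultragraph).
Variables (H : set (set (vertex G))) (B : set (vertex G)).
Hypothesis adm : admissible_pair H B.
Variables (A D : cstarAlgType K) (s : edge G -> A) (p : set (vertex G) -> A).
Hypothesis ck : ck_family s p.
Variable f : A -> D.
Hypothesis fH : star_hom f.
Local Notation xG := (extended H B).
Local Notation cls := (@quot_class G H B).
Local Notation xs := (@xset G H B).
Implicit Types (v : vertex G) (e : edge G) (X Y : set (vertex G)).
Implicit Types (C E : set (vertex xG)) (w : new_vertex H B).

Lemma star_hom_core v : finite_set (edges_outside H v) ->
  f (core H s v) = core H (f \o s) v.
Proof.
move=> vfin; rewrite /core star_hom_fsum//; apply: eq_fsbigr => e _ /=.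
by rewrite (star_homM fH) (star_homS fH).
Qed.

Hypothesis f_hereditary : forall X, H X -> f (p X) = 0.
Hypothesis f_gap : forall v, B v -> f (gap_projection H s p v) = 0.

(** A choice of representative; hom_ext_proj_equiv makes the value independent
    of it. *)
Definition class_proj (c : set (set (vertex xG))) : D :=
  f (ext_proj s p (xget set0 [set C : set (vertex xG) | gsets C /\ c = cls C])).

(** Adding a member of H to C changes its projection by one that f kills. *)
Lemma hom_ext_proj_equiv C E : gsets C -> gsets E -> quot_equiv C E ->
  f (ext_proj s p C) = f (ext_proj s p E).
Proof.
move=> gC gE [_ [X HX <-]]; rewrite -(xset_hereditary adm HX) => CE.
have gX : gsets (xs X : set (vertex xG)).
  by apply: gsets_xset; exact: (admissible_gsets adm).
have absorb (F : set (vertex xG)) : gsets F -> f (ext_proj s p (F `|` xs X)) = f (ext_proj s p F).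
  move=> gF; rewrite (ext_projU adm ck)// (ext_projI adm ck)//.
  rewrite ext_proj_xset (star_homB fH) (star_homD fH) (star_homM fH).
  by rewrite f_hereditary// smul0r addr0 subr0.
by rewrite -absorb// CE absorb.
Qed.

Lemma class_projE C : gsets C -> class_proj (cls C) = f (ext_proj s p C).
Proof.
move=> gC; rewrite /class_proj; case: xgetP => [E _ [gE CE]|/(_ C)[]//].
by apply/esym/hom_ext_proj_equiv => //; exact: (quot_class_inv adm).
Qed.

Lemma hom_edge_hereditary e : H (rng e) -> f (s e) = 0.
Proof.
move=> He; rewrite -(ck_partial_isometry ck e) -smulA (ck_range ck).
by rewrite (star_homM fH) f_hereditary// smul0r.
Qed.

(** If v has a new copy, ext_proj removes its gap; if v is in B, f kills the gap;
    otherwise v is regular, its Cuntz-Krieger relation holds in A, and f kills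
    the edges with range in H. *)
Lemma hom_ext_proj_inl v : ~ H [set v] ->
  edges_outside H v !=set0 -> finite_set (edges_outside H v) ->
  f (ext_proj s p ([set inl v] : set (vertex xG))) = f (core H s v).
Proof.
move=> Hv v0 vfin.
have [/new_vertexP[w <-]|vN] := pselect ((breaking H `\` B) v).
  by rewrite ext_proj_new.
rewrite -(xset_old vN) ext_proj_xset.
have [Bv|Bv] := pselect (B v).
  by apply/subr0_eq; rewrite -(star_homB fH) f_gap.
have vreg : regular v.
  split; first by have [e [ev _]] := v0; exists e.
  by apply: contrapT => vinf; apply: vN; split.
rewrite (ck_regular ck vreg) /core !star_hom_fsum//; last exact: vreg.2.
apply/esym/fsbig_widen => [e [] //|e [/= ev eo]].
rewrite (star_homM fH) hom_edge_hereditary ?smul0l//.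
by apply: contrapT => He; apply: eo.
Qed.

(** Multiplicativity and additivity already hold for ext_proj; killing the
    generators of the ideal is what provides the relations at the vertices. *)
Lemma pushed_quot_rep : quot_rep (fun e : edge xG => f (s e)) class_proj.
Proof.
have g0 : gsets (set0 : set (vertex xG)).
  have -> : (set0 : set (vertex xG)) = xs set0 by apply/seteqP; split=> -[].
  by apply: gsets_xset; apply: (admissible_gsets adm); exact: hereditary0 adm.
split.
- move=> e _; rewrite /partial_isometry -(star_homS fH) -!(star_homM fH).
  by rewrite (ck_partial_isometry ck).
- move=> _ [C gC <-]; rewrite class_projE//; split.
    by rewrite -(star_homM fH) -(ext_projI adm ck)// setIid.
  by rewrite -(star_homS fH) (ext_proj_star adm ck).
- rewrite class_projE//.
  have -> : (set0 : set (vertex xG)) = xs set0 by apply/seteqP; split=> -[].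
  by rewrite ext_proj_xset (ck_set0 ck) (star_hom0 fH).
- move=> C E gC gE; rewrite !class_projE//; last exact: gsetsI.
  by rewrite (ext_projI adm ck)// (star_homM fH).
- move=> C E gC gE; rewrite !class_projE//; [|exact: gsetsI|exact: gsetsU].
  by rewrite (ext_projU adm ck)// (star_homB fH) (star_homD fH).
- move=> e _; rewrite -(star_homS fH) -(star_homM fH) (ck_range ck).
  rewrite class_projE; last exact: (@gsets_rng xG e).
  by rewrite ext_proj_xset.
- move=> e e' _ _ ee'; rewrite -(star_homS fH) -(star_homM fH).
  by rewrite (ck_orthogonal ck)// (star_hom0 fH).
- move=> e /(quot_edgesE adm) He.
  rewrite /proj_le /quot_src /= (xsrcE _ He) class_projE; last exact: gsets_inl.
  rewrite -(star_homS fH) -!(star_homM fH); congr f.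
  have [/new_vertexP[w wv]|vN] := pselect ((breaking H `\` B) (@src G e)).
    by rewrite -wv ext_proj_new (core_rangeM ck)//; exact: new_edges_finite.
  by rewrite -(xset_old vN) ext_proj_xset (ck_source ck).
- move=> _ [[v /= Hv <-]|[w _ <-]]; last by rewrite (quot_emitted_inr adm) => -[].
  rewrite (quot_emitted_inl adm Hv) => v0 vfin.
  rewrite class_projE; last exact: gsets_inl.
  by rewrite hom_ext_proj_inl// star_hom_core.
Qed.

End PushedRepresentation.

Section PulledFamily.
Variables (K : numClosedFieldType) (G : ultragraph).
Variables (H : set (set (vertex G))) (B : set (vertex G)).
Hypothesis adm : admissible_pair H B.
Local Notation xG := (extended H B).
Local Notation cls := (@quot_class G H B).
Local Notation xs := (@xset G H B).
Variables (D : cstarAlgType K) (T : edge xG -> D).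
Variable (Q : set (set (vertex xG)) -> D).
Hypothesis rep : quot_rep T Q.
Implicit Types (v : vertex G) (e : edge G) (X Y : set (vertex G)).
Implicit Types (C E : set (vertex xG)) (w : new_vertex H B).

Definition pulled_edge e : D := if `[< H (rng e) >] then 0 else T e.

Definition pulled_proj X : D := Q (cls (xs X)).

Lemma pulled_edgeE e : ~ H (rng e) -> pulled_edge e = T e.
Proof. by move=> He; rewrite /pulled_edge asboolF. Qed.

Lemma pulled_edge0 e : H (rng e) -> pulled_edge e = 0.
Proof. by move=> He; rewrite /pulled_edge asboolT. Qed.

Lemma pulled_hereditary X : H X -> pulled_proj X = 0.
Proof.
by move=> HX; rewrite /pulled_proj (quot_class_hereditary adm HX) (qr_set0 rep).
Qed.

Lemma outside_notin v : edges_outside H v !=set0 -> ~ H [set v].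
Proof. by move=> [e [<- He]] /(emitted_hereditary adm). Qed.

Lemma pulled_core v : edges_outside H v !=set0 -> finite_set (edges_outside H v) ->
  Q (cls [set inl v]) = core H pulled_edge v.
Proof.
move=> v0 vfin; have Hv := outside_notin v0.
rewrite (qr_regular rep) ?(quot_emitted_inl adm Hv)//; last by left; exists v.
by apply: eq_fsbigr => e /set_mem[_ He]; rewrite pulled_edgeE.
Qed.

(** A regular vertex v has no new copy. Saturation is needed for its relation:
    if v is not in H then some edge out of v survives, so that the class of v is
    regular in the quotient. *)
Lemma pulled_ck_family : ck_family pulled_edge pulled_proj.
Proof.
have gx X : gsets X -> gsets (xs X : set (vertex xG)) by exact: gsets_xset.
split.
- move=> e; rewrite /partial_isometry; have [He|He] := pselect (H (rng e)).
    by rewrite pulled_edge0// !smul0l.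
  by rewrite pulled_edgeE// (qr_partial_isometry rep)//; exact/(quot_edgesE adm).
- move=> e e' ee'; have [He|He] := pselect (H (rng e)).
    by rewrite pulled_edge0// star0 smul0l.
  have [He'|He'] := pselect (H (rng e')).
    by rewrite (pulled_edge0 He') smul0r.
  rewrite !pulled_edgeE//; by apply: (qr_orthogonal rep) => //;
    apply/(quot_edgesE adm).
- by move=> X gX; apply: (qr_projection rep); exists (xs X) => //; exact: gx.
- exact/pulled_hereditary/(hereditary0 adm).
- by move=> X Y gX gY; rewrite /pulled_proj xsetI (qr_setI rep)//; exact: gx.
- move=> X Y gX gY; rewrite /pulled_proj xsetI xsetU (qr_setU rep)//; exact: gx.
- move=> e; have [He|He] := pselect (H (rng e)).
    by rewrite pulled_edge0// smul0r pulled_hereditary.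
  by rewrite pulled_edgeE// (qr_range rep)//; exact/(quot_edgesE adm).
- move=> e; rewrite /proj_le; have [He|He] := pselect (H (rng e)).
    by rewrite pulled_edge0// smul0l smul0r.
  have /(quot_edgesE adm) qe := He.
  rewrite pulled_edgeE// -(qr_source rep qe) smulA /quot_src /= (xsrcE _ He).
  rewrite /pulled_proj -(qr_setI rep); [|exact: gx (gsets1 _)|exact: gsets_inl].
  rewrite (_ : _ `&` _ = [set inl (src e)])//.
  by apply/seteqP; split=> [x []|x ->].
- move=> v vreg; have vN : ~ (breaking H `\` B) v.
    by move=> [[vinf _] _] _; exact: vinf vreg.2.
  have osub : edges_outside H v `<=` emitted v by move=> e [].
  have ofin : finite_set (edges_outside H v) by exact: sub_finite_set vreg.2.
  have widen : core H pulled_edge v =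
      \sum_(e \in emitted v) (pulled_edge e ** star (pulled_edge e)).
    apply: fsbig_widen => // e [/= ev eo].
    rewrite pulled_edge0 ?smul0l//.
    by apply: contrapT => He; apply: eo.
  rewrite -widen; have [Hv|Hv] := pselect (H [set v]).
    rewrite pulled_hereditary// widen fsbig1// => e ev.
    rewrite pulled_edge0 ?smul0l//.
    by apply: (emitted_hereditary adm); rewrite (ev : src e = v).
  rewrite -pulled_core//; first by rewrite /pulled_proj xset_old.
  have [_ sat _] := adm; apply: contrapT => o0; apply/Hv/sat => // e ev.
  by apply: contrapT => He; apply: o0; exists e.
Qed.

(** By additivity, since xset [set w] consists of w and w' and the range
    projections of the surviving edges sum to the projection of w. *)
Lemma pulled_gap_new w :
  gap_projection H pulled_edge pulled_proj (val w) = Q (cls [set inr w]).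
Proof.
have /set_mem[[_ w0 wfin] _] := valP w.
rewrite gapE -pulled_core// /pulled_proj xset_new (qr_setU rep);
  [|exact: gsets_inl|exact: gsets_inr].
rewrite (_ : _ `&` _ = set0) ?(qr_set0 rep) ?subr0; last first.
  by apply/seteqP; split=> // x [->].
by rewrite addrAC subrr add0r.
Qed.

Lemma pulled_gap_old v : B v -> gap_projection H pulled_edge pulled_proj v = 0.
Proof.
move=> Bv; have [_ _ /(_ v Bv)[_ v0 vfin]] := adm.
rewrite gapE -pulled_core// /pulled_proj xset_old ?subrr//.
by move=> [].
Qed.

End PulledFamily.

(** Additivity gives the value on a difference from those on X and on the
    intersection, so agreement spreads from the generators to all of gsets G. *)
Lemma additive_gsets_ext (K : numClosedFieldType) (G : ultragraph)
    (D : cstarAlgType K) (P Q : set (vertex G) -> D) :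
  P set0 = Q set0 ->
  (forall X Y, gsets X -> gsets Y -> P (X `&` Y) = P X ** P Y) ->
  (forall X Y, gsets X -> gsets Y -> Q (X `&` Y) = Q X ** Q Y) ->
  (forall X Y, gsets X -> gsets Y -> P (X `|` Y) = P X + P Y - P (X `&` Y)) ->
  (forall X Y, gsets X -> gsets Y -> Q (X `|` Y) = Q X + Q Y - Q (X `&` Y)) ->
  (forall v, P [set v] = Q [set v]) -> (forall e, P (rng e) = Q (rng e)) ->
  forall X, gsets X -> P X = Q X.
Proof.
move=> PQ0 PI QI PU QU PQ1 PQr; apply: gsets_ind => // X Y gX gY PQX PQY.
- by rewrite PI// QI// PQX PQY.
- by rewrite PU// QU// PI// QI// PQX PQY.
have gI := gsetsI gX gY; have gD := gsetsD gX gY.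
have DI : (X `\` Y) `&` (X `&` Y) = set0.
  by apply/seteqP; split=> // x [[_ nY] [_]].
have DU : (X `\` Y) `|` (X `&` Y) = X.
  apply/seteqP; split=> [x [[]|[]]//|x Xx].
  by have [Yx|Yx] := pselect (Y x); [right|left].
have split_at (F : set (vertex G) -> D) :
    (forall X Y, gsets X -> gsets Y -> F (X `|` Y) = F X + F Y - F (X `&` Y)) ->
    F (X `\` Y) = F X + F set0 - F (X `&` Y).
  by move=> /(_ _ _ gD gI); rewrite DU DI => ->; rewrite subrK addrK.
by rewrite !split_at// PQX PQ0 PI// QI// PQX PQY.
Qed.

(** * The isomorphism *)

Section PushPull.
Variables (K : numClosedFieldType) (G : ultragraph).
Variables (H : set (set (vertex G))) (B : set (vertex G)).
Hypothesis adm : admissible_pair H B.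
Local Notation xG := (extended H B).
Local Notation cls := (@quot_class G H B).
Local Notation xs := (@xset G H B).
Variables (A D : cstarAlgType K) (s : edge G -> A) (p : set (vertex G) -> A).
Hypothesis ck : ck_family s p.
Variables (T : edge xG -> D) (Q : set (set (vertex xG)) -> D).
Hypothesis rep : quot_rep T Q.
Variable g : A -> D.
Hypothesis gH : star_hom g.
Hypothesis gs : forall e, g (s e) = pulled_edge T e.
Hypothesis gp : forall X, gsets X -> g (p X) = pulled_proj Q X.

Lemma hom_core v : finite_set (edges_outside H v) ->
  g (core H s v) = core H (pulled_edge T) v.
Proof.
move=> vfin; rewrite (star_hom_core s gH)//.
by apply: eq_fsbigr => e _ /=; rewrite gs.
Qed.

Lemma hom_gap v : finite_set (edges_outside H v) ->
  g (gap_projection H s p v) =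
  gap_projection H (pulled_edge T) (pulled_proj Q) v.
Proof.
by move=> vfin; rewrite !gapE (star_homB gH) (gp (gsets1 v)) hom_core.
Qed.

Lemma hom_ideal_generators x : ideal_generators H B s p x -> g x = 0.
Proof.
move=> [[X HX <-]|[v Bv <-]].
  rewrite gp; last exact: (admissible_gsets adm).
  exact: (pulled_hereditary adm rep).
have [_ _ /(_ v Bv)[_ _ vfin]] := adm.
by rewrite hom_gap// (pulled_gap_old adm rep).
Qed.

(** Both sides are multiplicative and additive in C, which leaves vertices and
    ranges to be compared. *)
Lemma hom_ext_proj C : gsets C -> g (ext_proj s p C) = Q (cls C).
Proof.
move: C; apply: (@additive_gsets_ext _ xG D (g \o ext_proj s p) (Q \o cls)).
- have -> : (set0 : set (vertex xG)) = xs set0 by apply/seteqP; split=> -[].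
  rewrite /= ext_proj_xset gp//.
  exact: (admissible_gsets adm) (hereditary0 adm).
- by move=> C E gC gE /=; rewrite (ext_projI adm ck)// (star_homM gH).
- by move=> C E gC gE /=; rewrite (qr_setI rep).
- move=> C E gC gE /=.
  by rewrite (ext_projU adm ck)// (star_homB gH) (star_homD gH).
- by move=> C E gC gE /=; rewrite (qr_setU rep).
- move=> [v|w] /=.
    have [/new_vertexP[w <-]|vN] := pselect ((breaking H `\` B) v).
      have /set_mem[[_ w0 wfin] _] := valP w.
      by rewrite ext_proj_new (pulled_core adm rep)// hom_core.
    by rewrite -(xset_old vN) ext_proj_xset gp//; exact: gsets1.
  rewrite (ext_proj_inr ck) hom_gap; last exact: new_edges_finite.
  exact (pulled_gap_new adm rep w).
- by move=> e; rewrite /= ext_proj_xset gp//; exact: gsets_rng.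
Qed.

End PushPull.

(** The map induced by g on the quotient inverts f, and two mutually inverse
    contractions are isometric. *)
Lemma inverse_pair_iso (R : realType) (A U : cstarAlgType R[i])
    (I : star_ideal A) (Icl : closed (I : set A)) (f : U -> quot_cstar Icl)
    (g : A -> U) (SA : set A) (SU : set U) :
  star_hom f -> star_hom g -> (forall x, ideal_set I x -> g x = 0) ->
  cstar_generated SA = setT -> (forall a, SA a -> f (g a) = quot_proj I a) ->
  cstar_generated SU = setT ->
  (forall x, SU x -> exists2 a, f x = quot_proj I a & g a = x) ->
  @cstar_quotient_iso R U A I f.
Proof.
move=> fH gH gI SAT fgS SUT gfS.
have prH : @star_hom _ A (quot_cstar Icl) (quot_proj I) := quot_proj_star_hom I.
have fg : f \o g =1 quot_proj I.
  by apply: (star_hom_ext (D := quot_cstar Icl) _ prH SAT fgS);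
    exact: star_hom_comp.
pose gbar (X : quot_cstar Icl) : U := g (repr (X : quot_star I)).
have gbarE x : gbar (quot_proj I x) = g x.
  by apply: subr0_eq; rewrite -(star_homB gH) gI//; exact: quot_repr.
have gbarH : star_hom gbar.
  split=> [c X Y|X Y|X]; have [x ->] := quot_projE X.
  - have [y ->] := quot_projE Y; rewrite -(star_homZ prH) -(star_homD prH).
    by rewrite !gbarE (star_homD gH) (star_homZ gH).
  - have [y ->] := quot_projE Y.
    by rewrite -(star_homM prH) !gbarE (star_homM gH).
  - by rewrite -(star_homS prH) !gbarE (star_homS gH).
have gf : gbar \o f =1 id.
  apply: (@star_hom_ext _ U U (gbar \o f) id _ _ _ SUT) => //.
    exact: star_hom_comp.
  by move=> x /gfS[a fa ga] /=; rewrite fa gbarE.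
split; first exact: fH.
  exists gbar; first exact: gf.
  by move=> X; have [x ->] := quot_projE X; rewrite gbarE; exact: fg.
move=> x; apply/eqP; rewrite eq_le; apply/andP; split.
  exact: (star_hom_contractive fH).
by rewrite -{1}(gf x) /=; exact: (star_hom_contractive gbarH).
Qed.

Lemma admissible_ideal_closed (K : numClosedFieldType) (G : ultragraph)
    (H : set (set (vertex G))) (B : set (vertex G))
    (adm : admissible_pair H B) (A : ultragraph_cstar K G) :
  closed (admissible_ideal adm A : set A).
Proof.
by have [] := closed_ideal_generated_closed (ideal_generators H B (@uc_s _ _ A) (@uc_p _ _ A)).
Qed.

Theorem proposition5p1 (R : realType) (G : ultragraph)
    (H : set (set (vertex G))) (B : set (vertex G))
    (adm : admissible_pair H B)
    (A : ultragraph_cstar R[i] G) (U : quotient_cstar R[i] H B) :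
  exists f : U -> quot_star (admissible_ideal adm A), cstar_quotient_iso f.
Proof.
set I := admissible_ideal adm A; have Icl : closed (I : set A) := @admissible_ideal_closed _ _ _ _ adm A.
pose s := @uc_s _ _ A; pose p := @uc_p _ _ A.
have ck : ck_family s p := uc_family A; have rep := uq_rep U.
pose pr : A -> quot_cstar Icl := quot_proj I.
have prH : star_hom pr := quot_proj_star_hom I.
have pr_gen x : ideal_generators H B s p x -> pr x = 0.
  by move=> gx; apply: quot_proj_eq0 => /= J [_]; apply.
have pr_p X : H X -> pr (p X) = 0 by move=> HX; apply: pr_gen; left; exists X.
have pr_gap v : B v -> pr (gap_projection H s p v) = 0.
  by move=> Bv; apply: pr_gen; right; exists v.
have [f [fH ft fq]] :=
  uq_universal U (pushed_quot_rep adm ck prH pr_p pr_gap).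
have [g [gH gs gp]] := uc_universal A (pulled_ck_family adm rep).
exists f; apply: (inverse_pair_iso (Icl := Icl) fH gH _ (uc_generated A) _
                                   (uq_generated U)).
- move=> x /(_ [set x | g x = 0]); apply; split; first exact: star_hom_kernel gH.
  exact: (hom_ideal_generators adm rep gH gs gp).
- move=> _ [[e _ <-]|[X gX <-]].
    rewrite gs; have [He|He] := pselect (H (rng e)).
      rewrite pulled_edge0// (star_hom0 fH); apply/esym.
      exact: (hom_edge_hereditary ck prH pr_p).
    by rewrite pulled_edgeE//; apply: ft; exact/(quot_edgesE adm).
  rewrite gp// /pulled_proj fq; last first.
    by exists (@xset G H B X) => //; exact: gsets_xset.
  rewrite (class_projE adm ck prH pr_p); last exact: gsets_xset.
  by rewrite ext_proj_xset.
move=> _ [[e qe <-]|[_ [C gC <-] <-]].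
  exists (s e); first exact: ft.
  by rewrite gs pulled_edgeE//; exact/(quot_edgesE adm).
exists (ext_proj s p C); last exact: (hom_ext_proj adm ck rep gH gs gp).
rewrite fq; last by exists C.
exact: (class_projE adm ck prH pr_p).
Qed.
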